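(* Let $m_1,m_2,m_3>0$ and $\gamma>0$. Let $q(t)=(q_1(t),q_2(t),q_3(t))$, $t\in(a,b)$, be a solution, defined on its maximal interval of existence, of Newton's equations $$m_a\ddot q_a=-\nabla_a V(q),\qquad a=1,2,3,\qquad V(q)=-\frac{\gamma\, I(q)}{\Delta(q)^2},$$ on $\{q\in\mathbb{C}^3:\Delta(q)\neq 0\}$, where $I(q)$ is the moment of inertia and $\Delta(q)$ the signed area of the triangle with vertices $q_1,q_2,q_3$. Suppose that along this solution the energy $H$, the linear momentum $P$, the angular momentum $J$ and the time derivative $\dot I$ all vanish, and let $I_0>0$ be the resulting constant value of $I$ along the solution. Let $\pi:\mathbb{C}^3\to\mathbb{R}^3$, $q\mapsto w=(w_1,w_2,w_3)$, be the shape space projection. Then: 1. The projected curve $w(t)=\pi(q(t))$ lies in one of the two open hemispheres $$\{w\in\mathbb{R}^3:\ w_1^2+w_2^2+w_3^2=\tfrac14 I_0^2,\ w_3>0\}\quad\text{or}\quad \{w\in\mathbb{R}^3:\ w_1^2+w_2^2+w_3^2=\tfrac14 I_0^2,\ w_3<0\},$$ and, up to reparametrization, it is a geodesic of the Jemisphere model of the hyperbolic plane, i.e. of that hemisphere endowed with the restriction of the metric $\dfrac{dw_1^2+dw_2^2+dw_3^2}{w_3^2}$. 2. The projected solution curve is the intersection of that hemisphere with a vertical plane: there are real constants $A,B,C$ with $(A,B)\neq(0,0)$ such that the image $\{w(t):t\in(a,b)\}$ is the set of points of the hemisphere satisfying $Aw_1+Bw_2=C$.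
   Context: The Euclidean plane $\mathbb{R}^2$ is identified with $\mathbb{C}$; $q_a\in\mathbb{C}$ is the position of the $a$-th point mass, of mass $m_a$; $v_a=\dot q_a$; $\nabla_a=\partial/\partial q_a$ is the gradient with respect to $q_a\in\mathbb{R}^2$ for the standard dot product $z\cdot z'=\mathrm{Re}(z\overline{z'})$; and $z\wedge z'=\mathrm{Im}(\overline{z}z')$. Signed area: $\Delta(q)=\frac12 (q_2-q_1)\wedge(q_3-q_1)$. Moment of inertia (about the center of mass): $I(q)=\dfrac{\sum_{a<b}m_am_b|q_a-q_b|^2}{m_1+m_2+m_3}$. Energy: $H=\frac12\sum_a m_a|v_a|^2+V(q)$. Linear momentum: $P=\sum_a m_a v_a$. Angular momentum: $J=\sum_a m_a\, q_a\wedge v_a$. $\dot I$ denotes the time derivative of $I(q(t))$. Shape space projection and Hopf–Jacobi coordinates: put $\mu_1=\dfrac{m_1m_2}{m_1+m_2}$, $\mu_2=\dfrac{m_3(m_1+m_2)}{m_1+m_2+m_3}$ and $$Z_1=\sqrt{\mu_1}\,(q_2-q_1),\qquad Z_2=\sqrt{\mu_2}\,\Big(q_3-\frac{m_1q_1+m_2q_2}{m_1+m_2}\Big).$$ Then $\pi(q)=(w_1,w_2,w_3)$ with $$w_1=\tfrac12\big(|Z_1|^2-|Z_2|^2\big),\qquad w_2+i\,w_3=\overline{Z_1}\,Z_2 .$$ These are invariant under orientation-preserving rigid motions of the plane and satisfy $w_1^2+w_2^2+w_3^2=I^2/4$ and $w_3=2\mu\,\Delta$, where $\mu^2=\dfrac{m_1m_2m_3}{m_1+m_2+m_3}$.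 In particular $w_3=0$ exactly for collinear triangles. *)

(* Defs.v *)
From Stdlib Require Export Reals.
From Coquelicot Require Export Coquelicot.
Open Scope R_scope.

Inductive body : Set := b1 | b2 | b3.

Definition body_eqb (i j : body) : bool :=
  match i, j with
  | b1, b1 | b2, b2 | b3, b3 => true
  | _, _ => false
  end.

Definition sum_bodies {G : AbelianMonoid} (f : body -> G) : G :=
  plus (plus (f b1) (f b2)) (f b3).

Definition config : Type := body -> C.

Definition move (q : config) (i : body) (z : C) : config :=
  fun j => if body_eqb i j then z else q j.

Definition wedge (z z' : C) : R := Im (Cconj z * z')%C.

Definition signed_area (q : config) : R :=
  / 2 * wedge (q b2 - q b1)%C (q b3 - q b1)%C.

Definition total_mass (m : body -> R) : R := m b1 + m b2 + m b3.

Definition inertia (m : body -> R) (q : config) : R :=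
  (m b1 * m b2 * Cmod (q b1 - q b2) ^ 2
   + m b1 * m b3 * Cmod (q b1 - q b3) ^ 2
   + m b2 * m b3 * Cmod (q b2 - q b3) ^ 2) / total_mass m.

(** Only meaningful where [signed_area q <> 0]. *)
Definition potential (m : body -> R) (gamma : R) (q : config) : R :=
  - (gamma * inertia m q / signed_area q ^ 2).

(** Gradient for the dot product [Re (z * Cconj z')], under which 1 and i are
    orthonormal. *)
Definition grad (f : C -> R) (z : C) : C :=
  (Derive (fun x => f (x, Im z)) (Re z), Derive (fun y => f (Re z, y)) (Im z)).

Definition grad_body (F : config -> R) (i : body) (q : config) : C :=
  grad (fun z => F (move q i z)) (q i).

Definition energy (m : body -> R) (gamma : R) (q v : config) : R :=
  / 2 * sum_bodies (fun i => m i * Cmod (v i) ^ 2) + potential m gamma q.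

Definition linear_momentum (m : body -> R) (v : config) : C :=
  sum_bodies (fun i => (RtoC (m i) * v i)%C).

Definition angular_momentum (m : body -> R) (q v : config) : R :=
  sum_bodies (fun i => m i * wedge (q i) (v i)).

Definition inside (a b : Rbar) (t : R) : Prop := Rbar_lt a t /\ Rbar_lt t b.

(** [q] is a function on all of [R], but only its values on the interval matter;
    [v] is its velocity. *)
Definition newton_solution (m : body -> R) (gamma : R) (a b : Rbar)
    (q v : R -> config) : Prop :=
  forall t, inside a b t ->
    signed_area (q t) <> 0 /\
    forall i,
      is_derive (fun s => q s i) t (v t i) /\
      exists acc : C,
        is_derive (fun s => v s i) t acc /\
        (RtoC (m i) * acc = - grad_body (potential m gamma) i (q t))%C.

Definition maximal_newton_solution (m : body -> R) (gamma : R) (a b : Rbar)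
    (q v : R -> config) : Prop :=
  newton_solution m gamma a b q v /\
  forall (a' b' : Rbar) (q' v' : R -> config),
    Rbar_le a' a -> Rbar_le b b' ->
    newton_solution m gamma a' b' q' v' ->
    (forall t, inside a b t -> forall i, q' t i = q t i) ->
    a' = a /\ b' = b.

Definition R3 : Type := (R * R * R)%type.
Definition w1 (w : R3) : R := fst (fst w).
Definition w2 (w : R3) : R := snd (fst w).
Definition w3 (w : R3) : R := snd w.

Definition jacobi1 (m : body -> R) (q : config) : C :=
  (RtoC (sqrt (m b1 * m b2 / (m b1 + m b2))) * (q b2 - q b1))%C.

Definition jacobi2 (m : body -> R) (q : config) : C :=
  (RtoC (sqrt (m b3 * (m b1 + m b2) / total_mass m))
   * (q b3 - (RtoC (m b1) * q b1 + RtoC (m b2) * q b2) / RtoC (m b1 + m b2)))%C.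

Definition shape (m : body -> R) (q : config) : R3 :=
  let Z1 := jacobi1 m q in
  let Z2 := jacobi2 m q in
  (/ 2 * (Cmod Z1 ^ 2 - Cmod Z2 ^ 2), Re (Cconj Z1 * Z2)%C, Im (Cconj Z1 * Z2)%C).

Inductive axis : Set := ax1 | ax2.

Definition sum_axes (f : axis -> R) : R := f ax1 + f ax2.

Definition coord (i : axis) (x : R * R) : R :=
  match i with ax1 => fst x | ax2 => snd x end.

Definition partial (i : axis) (f : R * R -> R) (x : R * R) : R :=
  match i with
  | ax1 => Derive (fun s => f (s, snd x)) (fst x)
  | ax2 => Derive (fun s => f (fst x, s)) (snd x)
  end.

Definition metric : Type := axis -> axis -> R * R -> R.

Definition metric_inv (g : metric) (i j : axis) (x : R * R) : R :=
  let det := g ax1 ax1 x * g ax2 ax2 x - g ax1 ax2 x * g ax2 ax1 x in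
  match i, j with
  | ax1, ax1 => g ax2 ax2 x / det
  | ax2, ax2 => g ax1 ax1 x / det
  | _, _ => - g i j x / det
  end.

Definition christoffel (g : metric) (k i j : axis) (x : R * R) : R :=
  / 2 * sum_axes (fun l =>
    metric_inv g k l x
    * (partial i (g j l) x + partial j (g i l) x - partial l (g i j) x)).

(** u''^k + sum_{i,j} Gamma^k_{ij} u'^i u'^j = 0. *)
Definition geodesic_in_coords (g : metric) (a b : Rbar) (u : R -> R * R) : Prop :=
  forall s, inside a b s -> forall k,
    let d i := Derive (fun r => coord i (u r)) in
    ex_derive (fun r => coord k (u r)) s /\
    ex_derive (d k) s /\
    Derive (d k) s
    + sum_axes (fun i => sum_axes (fun j =>
        christoffel g k i j (u s) * d i s * d j s)) = 0.

(** The upper ([eps = 1]) or lower ([eps = -1]) open hemisphere of radius [I0 / 2]. *)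
Definition hemisphere (I0 eps : R) (w : R3) : Prop :=
  w1 w ^ 2 + w2 w ^ 2 + w3 w ^ 2 = / 4 * I0 ^ 2 /\ 0 < eps * w3 w.

(** The inverse of the global chart [w |-> (w1, w2)] of the hemisphere, on the
    open disc of radius [I0 / 2]. *)
Definition hemisphere_param (I0 eps : R) (x : R * R) : R3 :=
  (fst x, snd x, eps * sqrt (/ 4 * I0 ^ 2 - fst x ^ 2 - snd x ^ 2)).

(** The ambient metric [(dw1^2 + dw2^2 + dw3^2) / w3^2] on tangent vectors at [w]. *)
Definition ambient_metric (w xi eta : R3) : R :=
  (w1 xi * w1 eta + w2 xi * w2 eta + w3 xi * w3 eta) / w3 w ^ 2.

Definition partial3 (i : axis) (X : R * R -> R3) (x : R * R) : R3 :=
  (partial i (fun y => w1 (X y)) x,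
   partial i (fun y => w2 (X y)) x,
   partial i (fun y => w3 (X y)) x).

(** The restriction of the ambient metric to the hemisphere, in the chart above. *)
Definition jemisphere_metric (I0 eps : R) : metric :=
  fun i j x =>
    let X := hemisphere_param I0 eps in
    ambient_metric (X x) (partial3 i X x) (partial3 j X x).

Definition jemisphere_geodesic (I0 eps : R) (a b : Rbar) (c : R -> R3) : Prop :=
  (forall s, inside a b s -> hemisphere I0 eps (c s)) /\
  geodesic_in_coords (jemisphere_metric I0 eps) a b (fun s => (w1 (c s), w2 (c s))).

(** [w] on [(a, b)] is [c] on [(a', b')] composed with a [C^1] diffeomorphism
    of [(a, b)] onto [(a', b')]. *)
Definition reparametrization (a b : Rbar) (w : R -> R3)
    (a' b' : Rbar) (c : R -> R3) : Prop :=
  exists tau : R -> R,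
    (forall t, inside a b t ->
       inside a' b' (tau t) /\
       ex_derive tau t /\ continuous (Derive tau) t /\ Derive tau t <> 0 /\
       w t = c (tau t)) /\
    (forall s, inside a' b' s -> exists t, inside a b t /\ tau t = s).

(* Main.v *)
Require Import Defs.
From Stdlib Require Import Lra Psatz Ranalysis5.

(** In the Jacobi coordinates [(Z1, Z2)] the potential is [- k I / w3^2], and vanishing of [J] and
    [dI/dt] makes the velocity Hermitian orthogonal to the position. Together with [H = 0] this
    gives [w1'' = w2'' = 0]: in the chart [(w1, w2)] of the hemisphere the shape moves at constant
    velocity on a chord. In that chart the Jemisphere metric is Klein's model, whose geodesics are
    the chords.

    To see that the whole chord is covered, write it as [w1 + i w2 = n (C + i x)] with [|n| = 1]
    and [x] affine in time. The combinations [s, d = (Z1 + i Z2) +- n (Z1 - i Z2)] then have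
    constant modulus and their arguments are multiples of [arcsin (x / r)], [r] being half the
    length of the chord. This explicit motion solves Newton's equations as long as [|x| < r], so
    by maximality the time interval is exactly [{|x| < r}]. *)

(** * Newton's equations in Jacobi coordinates *)

(** Maximality is a statement about extensions, so covering the whole chord requires a solution on
    the full time interval that agrees with the given positions on [(a, b)]. Knowing the shape curve
    is therefore not enough: the rotation of the triangle must be integrated as well.

    The variables [s], [d] come from the Hopf map. For the pair [Z1 + i Z2], [Z1 - i Z2] the polar
    axis is that of [w3]; a further unitary change, up to scale, moves the axis to the horizontal
    direction [n], normal to the plane of the chord. Then [|s|^2 - |d|^2 = 8 C] is constant, and the
    relative argument of [s] and [d] is, up to a constant, the angle on the half circle
    [w3^2 + x^2 = r^2] cut out by that plane. Zero angular momentum reads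
    [|s|^2 arg(s)' + |d|^2 arg(d)' = 0], so it splits this angle in a fixed ratio and makes both
    arguments explicit. The ends [|x| = r] are collinear triangles, where the potential is
    singular. *)

Lemma is_derive_C_iff (f : R -> C) (t : R) (l : C) :
  is_derive f t l <->
  is_derive (fun s => Re (f s)) t (Re l) /\ is_derive (fun s => Im (f s)) t (Im l).
Proof.
  split.
  - intros H; split.
    + apply (filterdiff_comp' f fst t (fun y => scal y l) fst); [exact H|].
      apply filterdiff_linear; apply is_linear_fst.
    + apply (filterdiff_comp' f snd t (fun y => scal y l) snd); [exact H|].
      apply filterdiff_linear; apply is_linear_snd.
  - intros [H1 H2].
    apply (is_derive_ext
      (fun s => plus (scal (Re (f s)) ((1, 0) : C)) (scal (Im (f s)) ((0, 1) : C)))).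
    { intros s; destruct (f s) as [x y].
      apply injective_projections; simpl;
        unfold scal, plus; simpl; unfold mult; simpl; ring. }
    replace l with (plus (scal (Re l) ((1, 0) : C)) (scal (Im l) ((0, 1) : C))).
    2:{ destruct l as [x y]. apply injective_projections; simpl;
        unfold scal, plus; simpl; unfold mult; simpl; ring. }
    apply @is_derive_plus; apply @is_derive_scal_l; assumption.
Qed.

Lemma Cmod_sqr (z : C) : Cmod z ^ 2 = Re z ^ 2 + Im z ^ 2.
Proof. unfold Cmod; rewrite pow2_sqrt; [reflexivity|]; simpl; nra. Qed.

Lemma is_derive_val (f : R -> R) (t l l' : R) : is_derive f t l -> l = l' -> is_derive f t l'.
Proof. intros H <-; exact H. Qed.

Lemma Derive_eta (f : R -> R) (t l : R) : is_derive f t l -> Derive (fun s : R => f s) t = l.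
Proof. apply is_derive_unique. Qed.

Definition mu1 (m : body -> R) : R := m b1 * m b2 / (m b1 + m b2).
Definition mu2 (m : body -> R) : R := m b3 * (m b1 + m b2) / total_mass m.

(** Coefficients of the position relative to the barycenter in the unnormalized Jacobi vectors. They
    are rational in the masses; the square roots enter only in [coef1] and [coef2]. *)
Definition ratio1 (m : body -> R) (i : body) : R :=
  match i with
  | b1 => - (m b2 / (m b1 + m b2))
  | b2 => m b1 / (m b1 + m b2)
  | b3 => 0
  end.

Definition ratio2 (m : body -> R) (i : body) : R :=
  match i with
  | b3 => (m b1 + m b2) / total_mass m
  | _ => - (m b3 / total_mass m)
  end.

Definition coef1 (m : body -> R) (i : body) : R := ratio1 m i / sqrt (mu1 m).
Definition coef2 (m : body -> R) (i : body) : R := ratio2 m i / sqrt (mu2 m).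

Definition barycenter (m : body -> R) (q : config) : C :=
  (sum_bodies (fun i => (RtoC (m i) * q i)%C) / RtoC (total_mass m))%C.

(** Inverse of the Jacobi coordinates [(barycenter, Z1, Z2)]. *)
Definition of_jacobi (m : body -> R) (G Z1 Z2 : C) : config :=
  fun i => (G + RtoC (coef1 m i) * Z1 + RtoC (coef2 m i) * Z2)%C.

(** Since [w3 ^ 2 = 4 * mu1 * mu2 * signed_area ^ 2], this is the constant [k] for which the
    potential reads [- k I / w3^2]. *)
Definition strength (m : body -> R) (gamma : R) : R := 4 * gamma * mu1 m * mu2 m.

Definition norm2 (Z1 Z2 : C) : R := Re Z1 ^ 2 + Im Z1 ^ 2 + Re Z2 ^ 2 + Im Z2 ^ 2.

(** Minus the gradient of [- k I / w3^2] with respect to [Z1] (below, [Z2]), where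
    [I = |Z1|^2 + |Z2|^2] and [w3 = wedge Z1 Z2]. *)
Definition force1 (k : R) (Z1 Z2 : C) : C :=
  (2 * k / wedge Z1 Z2 ^ 2 * (Re Z1 - norm2 Z1 Z2 / wedge Z1 Z2 * Im Z2),
   2 * k / wedge Z1 Z2 ^ 2 * (Im Z1 + norm2 Z1 Z2 / wedge Z1 Z2 * Re Z2)).

Definition force2 (k : R) (Z1 Z2 : C) : C :=
  (2 * k / wedge Z1 Z2 ^ 2 * (Re Z2 + norm2 Z1 Z2 / wedge Z1 Z2 * Im Z1),
   2 * k / wedge Z1 Z2 ^ 2 * (Im Z2 - norm2 Z1 Z2 / wedge Z1 Z2 * Re Z1)).

Section Jacobi.

Variable m : body -> R.
Hypothesis hm : forall i, 0 < m i.

Lemma mu1_pos : 0 < mu1 m.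
Proof.
  pose proof (hm b1); pose proof (hm b2). unfold mu1, Rdiv.
  apply Rmult_lt_0_compat; [nra|]; apply Rinv_0_lt_compat; lra.
Qed.

Lemma mu2_pos : 0 < mu2 m.
Proof.
  pose proof (hm b1); pose proof (hm b2); pose proof (hm b3). unfold mu2, total_mass, Rdiv.
  apply Rmult_lt_0_compat; [nra|]; apply Rinv_0_lt_compat; lra.
Qed.

Ltac masses :=
  pose proof (hm b1) as Hm1; pose proof (hm b2) as Hm2; pose proof (hm b3) as Hm3;
  pose proof (sqrt_lt_R0 _ mu1_pos) as Hr1; pose proof (sqrt_lt_R0 _ mu2_pos) as Hr2;
  pose proof (pow2_sqrt _ (Rlt_le _ _ mu1_pos)) as Er1;
  pose proof (pow2_sqrt _ (Rlt_le _ _ mu2_pos)) as Er2.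

Lemma jacobi1_re (q : config) : Re (jacobi1 m q) = sqrt (mu1 m) * (Re (q b2) - Re (q b1)).
Proof. unfold jacobi1, mu1, Re, Im; simpl; ring. Qed.

Lemma jacobi1_im (q : config) : Im (jacobi1 m q) = sqrt (mu1 m) * (Im (q b2) - Im (q b1)).
Proof. unfold jacobi1, mu1, Re, Im; simpl; ring. Qed.

Lemma jacobi2_re (q : config) :
  Re (jacobi2 m q) =
  sqrt (mu2 m) * (Re (q b3) - (m b1 * Re (q b1) + m b2 * Re (q b2)) / (m b1 + m b2)).
Proof. unfold jacobi2, mu2, Re; simpl. masses. field. nra. Qed.

Lemma jacobi2_im (q : config) :
  Im (jacobi2 m q) =
  sqrt (mu2 m) * (Im (q b3) - (m b1 * Im (q b1) + m b2 * Im (q b2)) / (m b1 + m b2)).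
Proof. unfold jacobi2, mu2, Im; simpl. masses. field. nra. Qed.

Lemma wedge_jacobi (q : config) :
  wedge (jacobi1 m q) (jacobi2 m q) = 2 * (sqrt (mu1 m) * sqrt (mu2 m)) * signed_area q.
Proof.
  masses. unfold wedge, signed_area.
  replace (Im (Cconj (jacobi1 m q) * jacobi2 m q)%C) with
    (Re (jacobi1 m q) * Im (jacobi2 m q) - Im (jacobi1 m q) * Re (jacobi2 m q))
    by (unfold Re, Im; simpl; ring).
  rewrite jacobi1_re, jacobi1_im, jacobi2_re, jacobi2_im. unfold wedge, Re, Im; simpl. field. lra.
Qed.

Lemma inertia_jacobi (q : config) : inertia m q = norm2 (jacobi1 m q) (jacobi2 m q).
Proof.
  masses. unfold inertia, norm2. rewrite !Cmod_sqr.
  rewrite jacobi1_re, jacobi1_im, jacobi2_re, jacobi2_im, !Rpow_mult_distr, Er1, Er2.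
  unfold Re, Im, mu1, mu2, total_mass; simpl. field. lra.
Qed.

Lemma of_jacobi_re (G Z1 Z2 : C) (i : body) :
  Re (of_jacobi m G Z1 Z2 i) = Re G + coef1 m i * Re Z1 + coef2 m i * Re Z2.
Proof. unfold of_jacobi, Re; simpl; ring. Qed.

Lemma of_jacobi_im (G Z1 Z2 : C) (i : body) :
  Im (of_jacobi m G Z1 Z2 i) = Im G + coef1 m i * Im Z1 + coef2 m i * Im Z2.
Proof. unfold of_jacobi, Im; simpl; ring. Qed.

Lemma jacobi1_of_jacobi (G Z1 Z2 : C) : jacobi1 m (of_jacobi m G Z1 Z2) = Z1.
Proof.
  masses. apply injective_projections.
  - change (Re (jacobi1 m (of_jacobi m G Z1 Z2)) = Re Z1). rewrite jacobi1_re.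
    unfold of_jacobi, coef1, coef2, ratio1, ratio2, total_mass, Re; simpl. field. lra.
  - change (Im (jacobi1 m (of_jacobi m G Z1 Z2)) = Im Z1). rewrite jacobi1_im.
    unfold of_jacobi, coef1, coef2, ratio1, ratio2, total_mass, Im; simpl. field. lra.
Qed.

Lemma jacobi2_of_jacobi (G Z1 Z2 : C) : jacobi2 m (of_jacobi m G Z1 Z2) = Z2.
Proof.
  masses. apply injective_projections.
  - change (Re (jacobi2 m (of_jacobi m G Z1 Z2)) = Re Z2). rewrite jacobi2_re.
    unfold of_jacobi, coef1, coef2, ratio1, ratio2, total_mass, Re; simpl. field. lra.
  - change (Im (jacobi2 m (of_jacobi m G Z1 Z2)) = Im Z2). rewrite jacobi2_im.
    unfold of_jacobi, coef1, coef2, ratio1, ratio2, total_mass, Im; simpl. field. lra.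
Qed.

Lemma of_jacobi_jacobi (q : config) (i : body) :
  of_jacobi m (barycenter m q) (jacobi1 m q) (jacobi2 m q) i = q i.
Proof.
  masses. unfold of_jacobi. apply injective_projections.
  - change (Re (barycenter m q + RtoC (coef1 m i) * jacobi1 m q
      + RtoC (coef2 m i) * jacobi2 m q)%C = Re (q i)).
    transitivity (Re (barycenter m q) + coef1 m i * Re (jacobi1 m q)
      + coef2 m i * Re (jacobi2 m q)); [unfold Re; simpl; ring|].
    rewrite jacobi1_re, jacobi2_re.
    unfold barycenter, sum_bodies, coef1, coef2, ratio1, ratio2, total_mass, Re; destruct i; simpl; unfold plus; simpl;
      field; lra.
  - change (Im (barycenter m q + RtoC (coef1 m i) * jacobi1 m q
      + RtoC (coef2 m i) * jacobi2 m q)%C = Im (q i)).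
    transitivity (Im (barycenter m q) + coef1 m i * Im (jacobi1 m q)
      + coef2 m i * Im (jacobi2 m q)); [unfold Im; simpl; ring|].
    rewrite jacobi1_im, jacobi2_im.
    unfold barycenter, sum_bodies, coef1, coef2, ratio1, ratio2, total_mass, Im; destruct i; simpl; unfold plus; simpl;
      field; lra.
Qed.

(** Here [r], [s] stand for [sqrt mu1], [sqrt mu2]. The divisors in [coef1], [coef2] meet the
    factors in the Jacobi vectors, so that only squares survive and the force is rational in masses
    and positions. *)
Lemma rescaled_force (r s p p' g J A c c' X Y X' Y' : R) :
  0 < r -> 0 < s -> r ^ 2 = p -> s ^ 2 = p' -> A <> 0 ->
  c / r * (2 * (4 * g * p * p') / (2 * (r * s) * A) ^ 2
           * (r * X + J / (2 * (r * s) * A) * (s * Y)))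
  + c' / s * (2 * (4 * g * p * p') / (2 * (r * s) * A) ^ 2
           * (s * X' + J / (2 * (r * s) * A) * (r * Y')))
  = 2 * g / A ^ 2 * (c * (X + J / (2 * p * A) * Y) + c' * (X' + J / (2 * p' * A) * Y')).
Proof. intros ? ? <- <- ?; field; lra. Qed.

(** * The gradient of the potential in Jacobi coordinates *)

Lemma signed_area_real (q : config) :
  signed_area q = / 2 * ((Re (q b2) - Re (q b1)) * (Im (q b3) - Im (q b1))
      - (Im (q b2) - Im (q b1)) * (Re (q b3) - Re (q b1))).
Proof. unfold signed_area, wedge, Re, Im; simpl; ring. Qed.

Lemma inertia_real (q : config) :
  inertia m q = (m b1 * m b2 * ((Re (q b1) - Re (q b2)) ^ 2 + (Im (q b1) - Im (q b2)) ^ 2)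
           + m b1 * m b3 * ((Re (q b1) - Re (q b3)) ^ 2 + (Im (q b1) - Im (q b3)) ^ 2)
           + m b2 * m b3 * ((Re (q b2) - Re (q b3)) ^ 2 + (Im (q b2) - Im (q b3)) ^ 2)) /
          (m b1 + m b2 + m b3).
Proof. masses. unfold inertia, total_mass. rewrite !Cmod_sqr. unfold Re, Im; simpl. field. lra. Qed.

Lemma force_re (gamma : R) (q : config) (i : body) :
  signed_area q <> 0 ->
  let k := strength m gamma in
  Re (of_jacobi m 0 (force1 k (jacobi1 m q) (jacobi2 m q))
                    (force2 k (jacobi1 m q) (jacobi2 m q)) i) =
  2 * gamma / signed_area q ^ 2 *
  (ratio1 m i * (Re (q b2) - Re (q b1) + inertia m q / (2 * mu1 m * signed_area q)
     * - (Im (q b3) - (m b1 * Im (q b1) + m b2 * Im (q b2)) / (m b1 + m b2)))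
   + ratio2 m i * (Re (q b3) - (m b1 * Re (q b1) + m b2 * Re (q b2)) / (m b1 + m b2)
     + inertia m q / (2 * mu2 m * signed_area q) * (Im (q b2) - Im (q b1)))).
Proof.
  intros Ha k. masses. rewrite of_jacobi_re.
  unfold force1, force2; cbn [Re fst]. rewrite <- inertia_jacobi, wedge_jacobi.
  rewrite jacobi1_re, jacobi1_im, jacobi2_re, jacobi2_im.
  unfold k, strength, coef1, coef2.
  rewrite <- (rescaled_force (sqrt (mu1 m)) (sqrt (mu2 m))) by assumption.
  cbn [Re RtoC fst]. ring.
Qed.

Lemma force_im (gamma : R) (q : config) (i : body) :
  signed_area q <> 0 ->
  let k := strength m gamma in
  Im (of_jacobi m 0 (force1 k (jacobi1 m q) (jacobi2 m q))
                    (force2 k (jacobi1 m q) (jacobi2 m q)) i) =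
  2 * gamma / signed_area q ^ 2 *
  (ratio1 m i * (Im (q b2) - Im (q b1) + inertia m q / (2 * mu1 m * signed_area q)
     * (Re (q b3) - (m b1 * Re (q b1) + m b2 * Re (q b2)) / (m b1 + m b2)))
   + ratio2 m i * (Im (q b3) - (m b1 * Im (q b1) + m b2 * Im (q b2)) / (m b1 + m b2)
     + inertia m q / (2 * mu2 m * signed_area q) * - (Re (q b2) - Re (q b1)))).
Proof.
  intros Ha k. masses. rewrite of_jacobi_im.
  unfold force1, force2; cbn [Im snd]. rewrite <- inertia_jacobi, wedge_jacobi.
  rewrite jacobi1_re, jacobi1_im, jacobi2_re, jacobi2_im.
  unfold k, strength, coef1, coef2.
  rewrite <- (rescaled_force (sqrt (mu1 m)) (sqrt (mu2 m))) by assumption.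
  cbn [Im RtoC snd]. ring.
Qed.

Lemma is_derive_quotient_sqr (gamma : R) (J A : R -> R) (x dJ dA : R) :
  A x <> 0 -> is_derive J x dJ -> is_derive A x dA ->
  is_derive (fun y => - (gamma * J y / A y ^ 2)) x
    (2 * gamma / A x ^ 2 * (J x * dA / A x - dJ / 2)).
Proof.
  intros Ha HJ HA. eapply is_derive_val.
  - auto_derive; [|reflexivity].
    repeat split; [eexists; apply HJ | eexists; apply HA | simpl; nra].
  - rewrite (Derive_eta _ _ _ HJ), (Derive_eta _ _ _ HA).
    field. exact Ha.
Qed.

Lemma is_derive_potential (gamma : R) (c : R -> config) (x dJ dA : R) :
  signed_area (c x) <> 0 ->
  is_derive (fun y => inertia m (c y)) x dJ ->
  is_derive (fun y => signed_area (c y)) x dA ->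
  is_derive (fun y => potential m gamma (c y)) x
    (2 * gamma / signed_area (c x) ^ 2 * (inertia m (c x) * dA / signed_area (c x) - dJ / 2)).
Proof.
  exact (is_derive_quotient_sqr gamma (fun y => inertia m (c y)) (fun y => signed_area (c y)) x dJ dA).
Qed.

(** The Jacobi coordinates turn the mass-weighted form into [M |G|^2 + |Z1|^2 + |Z2|^2], [M] being
    the total mass, so gradients for it are ordinary gradients in [(Z1, Z2)]. The barycentric
    component is [0] because the potential is translation invariant. *)
Lemma newton_force (gamma : R) (q : config) (i : body) :
  signed_area q <> 0 ->
  let k := strength m gamma in
  (RtoC (m i) * of_jacobi m 0 (force1 k (jacobi1 m q) (jacobi2 m q))
                              (force2 k (jacobi1 m q) (jacobi2 m q)) i
   = - grad_body (potential m gamma) i q)%C.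
Proof.
  intros Ha k.
  pose proof (force_re gamma q i Ha) as HR. pose proof (force_im gamma q i Ha) as HI.
  cbv zeta in HR, HI. fold k in HR, HI.
  set (F := of_jacobi m 0 _ _ i) in *. clearbody F.
  masses. clear Hr1 Hr2 Er1 Er2.
  (* [move] with the old position gives back [q] only pointwise; the inertia and the area depend on
     nothing but the three values. *)
  assert (Hself : forall f : config,
    (forall j, f j = q j) -> inertia m f = inertia m q /\ signed_area f = signed_area q).
  { intros f Hf. rewrite !inertia_real, !signed_area_real, !Hf. split; reflexivity. }
  assert (Hx : forall j, move q i (Re (q i), Im (q i)) j = q j).
  { intros j. unfold move. destruct (q i) as [x y] eqn:E; destruct i, j; simpl; congruence. }
  destruct (Hself _ Hx) as [SJ SA]. clear Hself Hx.
  assert (Hpart : forall (c : R -> config) (x dJ dA l : R),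
    inertia m (c x) = inertia m q -> signed_area (c x) = signed_area q ->
    is_derive (fun y => inertia m (c y)) x dJ ->
    is_derive (fun y => signed_area (c y)) x dA ->
    - (2 * gamma / signed_area q ^ 2 * (inertia m q * dA / signed_area q - dJ / 2)) = l ->
    l = - Derive (fun y => potential m gamma (c y)) x).
  { intros c x dJ dA l EJ EA DJ DA <-. apply f_equal. symmetry. apply is_derive_unique.
    rewrite <- EJ, <- EA. apply is_derive_potential; [rewrite EA; exact Ha | exact DJ | exact DA]. }
  apply injective_projections.
  - transitivity (m i * Re F); [unfold Re; simpl; ring|]. rewrite HR.
    cbn [Copp fst grad_body grad]. clear HR HI.
    destruct i;
      (eapply Hpart;
       [exact SJ | exact SA
       | eapply is_derive_ext; [intros x; symmetry; apply inertia_real|];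
         unfold move; cbn [body_eqb Re Im fst snd]; auto_derive; [exact I|reflexivity]
       | eapply is_derive_ext; [intros x; symmetry; apply signed_area_real|];
         unfold move; cbn [body_eqb Re Im fst snd]; auto_derive; [exact I|reflexivity]
       | unfold ratio1, ratio2, mu1, mu2, total_mass; field; lra]).
  - transitivity (m i * Im F); [unfold Im; simpl; ring|]. rewrite HI.
    cbn [Copp snd grad_body grad]. clear HR HI.
    destruct i;
      (eapply Hpart;
       [exact SJ | exact SA
       | eapply is_derive_ext; [intros x; symmetry; apply inertia_real|];
         unfold move; cbn [body_eqb Re Im fst snd]; auto_derive; [exact I|reflexivity]
       | eapply is_derive_ext; [intros x; symmetry; apply signed_area_real|];
         unfold move; cbn [body_eqb Re Im fst snd]; auto_derive; [exact I|reflexivity]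
       | unfold ratio1, ratio2, mu1, mu2, total_mass; field; lra]).
Qed.

End Jacobi.

(** * The explicit motion *)

Lemma inside_between (a b : Rbar) (s t u : R) :
  inside a b s -> inside a b t -> s <= u <= t -> inside a b u.
Proof.
  intros [Hs _] [_ Ht] [H1 H2]. split.
  - apply Rbar_lt_le_trans with s; [exact Hs | exact H1].
  - apply Rbar_le_lt_trans with t; [exact H2 | exact Ht].
Qed.

Lemma constant_on_interval (a b : Rbar) (f : R -> R) :
  (forall t, inside a b t -> is_derive f t 0) ->
  forall s t, inside a b s -> inside a b t -> f s = f t.
Proof.
  intros Hf.
  assert (H : forall s t, inside a b s -> inside a b t -> s < t -> f s = f t).
  { intros s t Hs Ht Hst. apply (eq_is_derive f s t); [|exact Hst].
    intros u Hu. apply Hf. exact (inside_between a b s t u Hs Ht Hu). }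
  intros s t Hs Ht. destruct (Rtotal_order s t) as [L | [-> | L]].
  - apply H; assumption.
  - reflexivity.
  - symmetry; apply H; assumption.
Qed.

Lemma affine_on_interval (a b : Rbar) (f : R -> R) (l : R) :
  (forall t, inside a b t -> is_derive f t l) ->
  forall s t, inside a b s -> inside a b t -> f t = f s + l * (t - s).
Proof.
  intros Hf s t Hs Ht.
  enough (E : f t - l * t = f s - l * s) by lra.
  apply (constant_on_interval a b (fun u => f u - l * u)); [|assumption|assumption].
  intros u Hu. eapply is_derive_val.
  - apply @is_derive_minus; [apply Hf, Hu|]. apply is_derive_scal. apply @is_derive_id.
  - unfold minus, plus, opp, one; simpl; ring.
Qed.

Lemma constant_sign (a b : Rbar) (f : R -> R) :
  (forall t, inside a b t -> continuous f t) ->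
  (forall t, inside a b t -> f t <> 0) ->
  exists eps, (eps = 1 \/ eps = -1) /\ forall t, inside a b t -> 0 < eps * f t.
Proof.
  intros Hc H0.
  assert (Hno : forall s t, inside a b s -> inside a b t -> s < t -> f s * f t < 0 -> False).
  { intros s t Hs Ht Hst Hneg.
    assert (Hcp : forall e, e <> 0 -> forall u, s <= u <= t -> continuity_pt (fun x => e * f x) u).
    { intros e _ u Hu. apply continuity_pt_mult.
      - apply continuity_pt_const. intros x y; reflexivity.
      - apply continuity_pt_filterlim. apply Hc. exact (inside_between a b s t u Hs Ht Hu). }
    destruct (Rlt_or_le (f s) 0) as [L | L].
    - destruct (IVT_interv (fun x => 1 * f x) s t) as [z [Hz E]].
      + apply Hcp; lra.
      + exact Hst.
      + lra.
      + nra.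
      + apply (H0 z); [exact (inside_between a b s t z Hs Ht Hz) | lra].
    - destruct (IVT_interv (fun x => -1 * f x) s t) as [z [Hz E]].
      + apply Hcp; lra.
      + exact Hst.
      + destruct (Req_dec (f s) 0); nra.
      + nra.
      + apply (H0 z); [exact (inside_between a b s t z Hs Ht Hz) | lra]. }
  assert (Hsame : forall s t, inside a b s -> inside a b t -> 0 < f s * f t).
  { intros s t Hs Ht.
    pose proof (H0 s Hs) as Ns. pose proof (H0 t Ht) as Nt.
    destruct (Rlt_or_le 0 (f s * f t)) as [L | L]; [exact L | exfalso].
    assert (f s * f t < 0).
    { destruct L as [L | L]; [exact L|]. apply Rmult_integral in L. tauto. }
    destruct (Rtotal_order s t) as [T | [-> | T]].
    - apply (Hno s t); assumption.
    - nra.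
    - apply (Hno t s); try assumption. lra. }
  destruct (Classical_Prop.classic (exists s, inside a b s)) as [[s Hs] | Hn].
  - destruct (Rlt_or_le 0 (f s)) as [L | L].
    + exists 1; split; [left; reflexivity|]. intros t Ht. specialize (Hsame s t Hs Ht). nra.
    + exists (-1); split; [right; reflexivity|]. intros t Ht. specialize (Hsame s t Hs Ht). nra.
  - exists 1; split; [left; reflexivity|]. intros t Ht. exfalso; apply Hn; exists t; exact Ht.
Qed.

(** [Z1 = p1 + i p2] and [Z2 = p3 + i p4] have velocities [u1 + i u2] and [u3 + i u4]. With
    [n = n1 + i n2], the combinations [s, d = (Z1 + i Z2) +- n (Z1 - i Z2)] satisfy
    [|s|^2 = 2 J + 4 C], [|d|^2 = 2 J - 4 C] and [s conj d = - 4 (w + i x)], so that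
    horizontality of the velocity forces [s] and [d] to rotate at rates that depend on [w] only. *)
Lemma spinor_velocity (J C sg x n1 n2 p1 p2 p3 p4 u1 u2 u3 u4 : R) :
  let w := p1 * p4 - p2 * p3 in
  w <> 0 -> 0 < J -> 0 < J + 2 * C -> 0 < J - 2 * C ->
  n1 ^ 2 + n2 ^ 2 = 1 ->
  p1 ^ 2 + p2 ^ 2 + p3 ^ 2 + p4 ^ 2 = J ->
  p1 * u1 + p2 * u2 + p3 * u3 + p4 * u4 = 0 ->
  p1 * u2 - p2 * u1 + (p3 * u4 - p4 * u3) = 0 ->
  / 2 * (p1 ^ 2 + p2 ^ 2 - p3 ^ 2 - p4 ^ 2) = n1 * C - n2 * x ->
  p1 * p3 + p2 * p4 = n2 * C + n1 * x ->
  p1 * u1 + p2 * u2 - p3 * u3 - p4 * u4 = - n2 * sg ->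
  u1 * p3 + p1 * u3 + u2 * p4 + p2 * u4 = n1 * sg ->
  let spin1 r1 r2 r3 r4 := r1 - r4 + (n1 * (r1 + r4) - n2 * (r2 - r3)) in
  let spin2 r1 r2 r3 r4 := r2 + r3 + (n2 * (r1 + r4) + n1 * (r2 - r3)) in
  let s1 := spin1 p1 p2 p3 p4 in
  let s2 := spin2 p1 p2 p3 p4 in
  let d1 := p1 - p4 - (n1 * (p1 + p4) - n2 * (p2 - p3)) in
  let d2 := p2 + p3 - (n2 * (p1 + p4) + n1 * (p2 - p3)) in
  s1 ^ 2 + s2 ^ 2 = 2 * J + 4 * C /\
  d1 = - 4 * (w * s1 + x * s2) / (2 * J + 4 * C) /\
  d2 = - 4 * (w * s2 - x * s1) / (2 * J + 4 * C) /\
  spin1 u1 u2 u3 u4 = - (sg * ((J - 2 * C) / (2 * J)) / w * s2) /\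
  spin2 u1 u2 u3 u4 = sg * ((J - 2 * C) / (2 * J)) / w * s1.
Proof.
  intros w Hw HJ HS HD En EJ Ed Ea E1 E2 EB1 EB2 spin1 spin2 s1 s2 d1 d2.
  set (ds1 := spin1 u1 u2 u3 u4). set (ds2 := spin2 u1 u2 u3 u4).
  set (dd1 := u1 - u4 - (n1 * (u1 + u4) - n2 * (u2 - u3))).
  set (dd2 := u2 + u3 - (n2 * (u1 + u4) + n1 * (u2 - u3))).
  (* The identities below hold modulo [|n| = 1]; a suitable multiple of this constraint makes each
     an identity of polynomials. The factor [h] is [|Z1 - i Z2|^2]. *)
  assert (N : forall y, y * (n1 ^ 2 + n2 ^ 2 - 1) = 0) by (intros y; rewrite En; ring).
  set (h := (p1 + p4) ^ 2 + (p2 - p3) ^ 2).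
  assert (Es : s1 ^ 2 + s2 ^ 2 = 2 * J + 4 * C).
  { transitivity (2 * J + 4 * (n1 * (n1 * C - n2 * x) + n2 * (n2 * C + n1 * x))
      - 4 * C * (n1 ^ 2 + n2 ^ 2 - 1) + h * (n1 ^ 2 + n2 ^ 2 - 1)); [|rewrite (N h); ring].
    rewrite (N (4 * C)), <- E1, <- E2, <- EJ. unfold s1, s2, spin1, spin2, h. field. }
  assert (Edn : d1 ^ 2 + d2 ^ 2 = 2 * J - 4 * C).
  { transitivity (2 * J - 4 * (n1 * (n1 * C - n2 * x) + n2 * (n2 * C + n1 * x))
      + 4 * C * (n1 ^ 2 + n2 ^ 2 - 1) + h * (n1 ^ 2 + n2 ^ 2 - 1)); [|rewrite (N h); ring].
    rewrite (N (4 * C)), <- E1, <- E2, <- EJ. unfold d1, d2, h. field. }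
  assert (Esd : s1 * d1 + s2 * d2 = - 4 * w).
  { transitivity (- 4 * w - h * (n1 ^ 2 + n2 ^ 2 - 1)); [|rewrite (N h); ring].
    unfold s1, s2, d1, d2, spin1, spin2, w, h. ring. }
  assert (Ecd : s2 * d1 - s1 * d2 = - 4 * x).
  { transitivity (- 4 * (n1 * (n2 * C + n1 * x) - n2 * (n1 * C - n2 * x))
      + 4 * x * (n1 ^ 2 + n2 ^ 2 - 1)); [|ring].
    rewrite (N (4 * x)), <- E1, <- E2. unfold s1, s2, d1, d2, spin1, spin2. field. }
  assert (Eds : s1 * ds1 + s2 * ds2 = 0).
  { transitivity (2 * (p1 * u1 + p2 * u2 + p3 * u3 + p4 * u4)
      + 2 * (n1 * (p1 * u1 + p2 * u2 - p3 * u3 - p4 * u4)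
        + n2 * (u1 * p3 + p1 * u3 + u2 * p4 + p2 * u4))
      + ((p1 + p4) * (u1 + u4) + (p2 - p3) * (u2 - u3)) * (n1 ^ 2 + n2 ^ 2 - 1)).
    - unfold s1, s2, ds1, ds2, spin1, spin2. ring.
    - rewrite Ed, EB1, EB2, N. ring. }
  assert (Edd : d1 * dd1 + d2 * dd2 = 0).
  { transitivity (2 * (p1 * u1 + p2 * u2 + p3 * u3 + p4 * u4)
      - 2 * (n1 * (p1 * u1 + p2 * u2 - p3 * u3 - p4 * u4)
        + n2 * (u1 * p3 + p1 * u3 + u2 * p4 + p2 * u4))
      + ((p1 + p4) * (u1 + u4) + (p2 - p3) * (u2 - u3)) * (n1 ^ 2 + n2 ^ 2 - 1)).
    - unfold d1, d2, dd1, dd2. ring.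
    - rewrite Ed, EB1, EB2, N. ring. }
  assert (Eh : (s1 * ds2 - s2 * ds1) + (d1 * dd2 - d2 * dd1) = 0).
  { transitivity (4 * (p1 * u2 - p2 * u1 + (p3 * u4 - p4 * u3))
      + 2 * ((p1 + p4) * (u2 - u3) - (p2 - p3) * (u1 + u4)) * (n1 ^ 2 + n2 ^ 2 - 1)).
    - unfold s1, s2, ds1, ds2, d1, d2, dd1, dd2, spin1, spin2. ring.
    - rewrite Ea, N. ring. }
  assert (Ex : ds2 * d1 - ds1 * d2 + (s2 * dd1 - s1 * dd2) = - 4 * sg).
  { transitivity (- 4 * (n1 * (u1 * p3 + p1 * u3 + u2 * p4 + p2 * u4)
      - n2 * (p1 * u1 + p2 * u2 - p3 * u3 - p4 * u4))).
    - unfold s1, s2, ds1, ds2, d1, d2, dd1, dd2, spin1, spin2. ring.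
    - rewrite EB1, EB2.
      transitivity (- 4 * sg - 4 * sg * (n1 ^ 2 + n2 ^ 2 - 1)); [ring | rewrite N; ring]. }
  clearbody s1 s2 d1 d2 ds1 ds2 dd1 dd2 w. clear - Hw HJ HS HD Es Edn Esd Ecd Eds Edd Eh Ex.
  (* [A] is the angular momentum of [s], and by [Eh] that of [d] is [- A]. As both moduli are
     constant, [A] determines both velocities. *)
  set (A := s1 * ds2 - s2 * ds1) in *.
  assert (G1 : (2 * J + 4 * C) * ds1 = - (A * s2)).
  { rewrite <- Es. transitivity (s1 * (s1 * ds1 + s2 * ds2) - A * s2);
      [unfold A; ring | rewrite Eds; ring]. }
  assert (G2 : (2 * J + 4 * C) * ds2 = A * s1).
  { rewrite <- Es. transitivity (s2 * (s1 * ds1 + s2 * ds2) + A * s1);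
      [unfold A; ring | rewrite Eds; ring]. }
  assert (HB : d1 * dd2 - d2 * dd1 = - A) by lra.
  assert (G3 : (2 * J - 4 * C) * dd1 = A * d2).
  { rewrite <- Edn. transitivity (d1 * (d1 * dd1 + d2 * dd2) - (d1 * dd2 - d2 * dd1) * d2);
      [ring | rewrite Edd, HB; ring]. }
  assert (G4 : (2 * J - 4 * C) * dd2 = - (A * d1)).
  { rewrite <- Edn. transitivity (d2 * (d1 * dd1 + d2 * dd2) + (d1 * dd2 - d2 * dd1) * d1);
      [ring | rewrite Edd, HB; ring]. }
  (* [Ex] is the derivative of [Ecd]. Multiplied by [|s|^2 |d|^2] it becomes linear in [A], with
     [|s|^2 + |d|^2 = 4 J] in the coefficient. *)
  assert (HA : A = (2 * J + 4 * C) * (sg * ((J - 2 * C) / (2 * J)) / w)).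
  { apply (Rmult_eq_reg_r (- 4 * w * (4 * J))).
    2:{ apply Rmult_integral_contrapositive; split; [lra|]. lra. }
    transitivity ((2 * J + 4 * C) * (2 * J - 4 * C)
      * (ds2 * d1 - ds1 * d2 + (s2 * dd1 - s1 * dd2))); [|rewrite Ex; field; lra].
    transitivity ((2 * J - 4 * C) * (((2 * J + 4 * C) * ds2) * d1 - ((2 * J + 4 * C) * ds1) * d2)
      + (2 * J + 4 * C) * (s2 * ((2 * J - 4 * C) * dd1) - s1 * ((2 * J - 4 * C) * dd2))); [|ring].
    rewrite G1, G2, G3, G4.
    transitivity (A * (s1 * d1 + s2 * d2) * (4 * J)); [rewrite Esd; ring | ring]. }
  repeat split.
  - exact Es.
  - apply (Rmult_eq_reg_l (2 * J + 4 * C)); [|lra].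
    transitivity (- 4 * (w * s1 + x * s2)); [|field; lra].
    rewrite <- Es. transitivity (s1 * (s1 * d1 + s2 * d2) + s2 * (s2 * d1 - s1 * d2)); [ring|].
    rewrite Esd, Ecd. ring.
  - apply (Rmult_eq_reg_l (2 * J + 4 * C)); [|lra].
    transitivity (- 4 * (w * s2 - x * s1)); [|field; lra].
    rewrite <- Es. transitivity (s2 * (s1 * d1 + s2 * d2) - s1 * (s2 * d1 - s1 * d2)); [ring|].
    rewrite Esd, Ecd. ring.
  - apply (Rmult_eq_reg_l (2 * J + 4 * C)); [|lra]. rewrite G1, HA. ring.
  - apply (Rmult_eq_reg_l (2 * J + 4 * C)); [|lra]. rewrite G2, HA. ring.
Qed.

Ltac derive_known :=
  auto_derive;
  [repeat split;
   try match goal with |- ex_derive (fun x => ?f x) _ =>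
     match goal with H : is_derive f _ _ |- _ => eexists; exact H end end
  | repeat match goal with |- context [Derive (fun x => ?f x) _] =>
     match goal with H : is_derive f _ _ |- _ => rewrite (Derive_eta f _ _ H) end end].

(** In the frame turned by [Phi] the vector [(f, g)] has zero derivative. The constants are its
    coordinates in that frame. *)
Lemma rotation_solution (a b : Rbar) (f g Phi kappa : R -> R) :
  (forall t, inside a b t -> is_derive Phi t (kappa t)) ->
  (forall t, inside a b t -> is_derive f t (- (kappa t * g t))) ->
  (forall t, inside a b t -> is_derive g t (kappa t * f t)) ->
  exists f0 g0, forall t, inside a b t ->
    f t = cos (Phi t) * f0 - sin (Phi t) * g0 /\ g t = sin (Phi t) * f0 + cos (Phi t) * g0.
Proof.
  intros HP Hf Hg.
  set (F := fun t => cos (Phi t) * f t + sin (Phi t) * g t).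
  set (G := fun t => cos (Phi t) * g t - sin (Phi t) * f t).
  assert (HF : forall t, inside a b t -> is_derive F t 0).
  { intros t Ht. pose proof (HP t Ht) as DP. pose proof (Hf t Ht) as Df. pose proof (Hg t Ht) as Dg.
    unfold F. derive_known. ring. }
  assert (HG : forall t, inside a b t -> is_derive G t 0).
  { intros t Ht. pose proof (HP t Ht) as DP. pose proof (Hf t Ht) as Df. pose proof (Hg t Ht) as Dg.
    unfold G. derive_known. ring. }
  destruct (Classical_Prop.classic (exists s, inside a b s)) as [[s Hs] | Hn].
  2:{ exists 0, 0. intros t Ht. exfalso. apply Hn. exists t. exact Ht. }
  exists (F s), (G s). intros t Ht.
  rewrite (constant_on_interval a b F HF s t Hs Ht), (constant_on_interval a b G HG s t Hs Ht).
  pose proof (sin2_cos2 (Phi t)) as E. unfold Rsqr in E. unfold F, G.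
  split.
  - transitivity ((sin (Phi t) * sin (Phi t) + cos (Phi t) * cos (Phi t)) * f t); [rewrite E|]; ring.
  - transitivity ((sin (Phi t) * sin (Phi t) + cos (Phi t) * cos (Phi t)) * g t); [rewrite E|]; ring.
Qed.

Lemma is_derive_affine2 (r c c' : R) (f g : R -> R) (t f' g' : R) :
  is_derive f t f' -> is_derive g t g' ->
  is_derive (fun s => r + c * f s + c' * g s) t (0 + c * f' + c' * g').
Proof. intros Hf Hg. derive_known. ring. Qed.

(** Inverse of [(Z1, Z2) |-> (s, d)]; see [spinor_velocity]. *)
Definition unspin1 (n1 n2 s1 s2 d1 d2 : R) : C :=
  ((s1 + d1 + (n1 * (s1 - d1) + n2 * (s2 - d2))) / 4,
   (s2 + d2 + (n1 * (s2 - d2) - n2 * (s1 - d1))) / 4).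

Definition unspin2 (n1 n2 s1 s2 d1 d2 : R) : C :=
  ((s2 + d2 - (n1 * (s2 - d2) - n2 * (s1 - d1))) / 4,
   - (s1 + d1 - (n1 * (s1 - d1) + n2 * (s2 - d2))) / 4).

Section Explicit.

Variables (J c0 sg x0 t0 eps k n1 n2 s01 s02 : R).

Hypotheses (hJ : 0 < J) (hS : 0 < J + 2 * c0) (hD : 0 < J - 2 * c0) (hsg : 0 < sg)
  (heps : eps = 1 \/ eps = -1)
  (hk : 2 * k * J ^ 2 = sg ^ 2 * (/ 4 * J ^ 2 - c0 ^ 2))
  (hn : n1 ^ 2 + n2 ^ 2 = 1)
  (hs0 : s01 ^ 2 + s02 ^ 2 = 2 * J + 4 * c0).

Definition x_of (t : R) : R := x0 + sg * (t - t0).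
(** Squared half length of the chord: the point [(x, w)] runs on a half circle with this squared
    radius, on which [angle] is the angular variable. *)
Definition rho2 : R := / 4 * J ^ 2 - c0 ^ 2.
Definition w_of (t : R) : R := eps * sqrt (rho2 - x_of t ^ 2).
(** A primitive of [sg / w_of]. *)
Definition angle (t : R) : R := eps * asin (x_of t / sqrt rho2).
(** This is [|d|^2 / (|s|^2 + |d|^2)], the share of the relative angle taken by [s]; [d] turns the
    other way with share [1 - rate], which balances the angular momenta. *)
Definition rate : R := (J - 2 * c0) / (2 * J).

Definition s1_of (t : R) : R := cos (rate * angle t) * s01 - sin (rate * angle t) * s02.
Definition s2_of (t : R) : R := sin (rate * angle t) * s01 + cos (rate * angle t) * s02.
(** Obtained by solving [s conj d = - 4 (w + i x)] for [d]. *)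
Definition d1_of (t : R) : R := - 4 * (w_of t * s1_of t + x_of t * s2_of t) / (2 * J + 4 * c0).
Definition d2_of (t : R) : R := - 4 * (w_of t * s2_of t - x_of t * s1_of t) / (2 * J + 4 * c0).

Lemma rho2_pos : 0 < rho2.
Proof. unfold rho2. nra. Qed.

Lemma eps_sqr : eps ^ 2 = 1.
Proof. destruct heps as [-> | ->]; ring. Qed.

Section AtTime.

Variable t : R.
Hypothesis ht : x_of t ^ 2 < rho2.

Lemma w_of_sqr : w_of t ^ 2 = rho2 - x_of t ^ 2.
Proof. unfold w_of. rewrite Rpow_mult_distr, eps_sqr, pow2_sqrt by lra. ring. Qed.

Lemma w_of_neq0 : w_of t <> 0.
Proof. intros E. pose proof w_of_sqr as H. rewrite E in H. lra. Qed.

Lemma is_derive_x_of : is_derive x_of t sg.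
Proof. unfold x_of. auto_derive; [exact I|]. ring. Qed.

Lemma is_derive_w_of : is_derive w_of t (- (sg * x_of t / w_of t)).
Proof.
  pose proof is_derive_x_of as Hx. pose proof w_of_neq0 as Hw.
  assert (0 < sqrt (rho2 - x_of t ^ 2)) as Hq by (apply sqrt_lt_R0; lra).
  unfold w_of in *. derive_known.
  - simpl in *. lra.
  - replace (rho2 + - (x_of t * (x_of t * 1))) with (rho2 - x_of t ^ 2) by ring.
    set (q := sqrt _) in *. destruct heps as [-> | ->]; field; lra.
Qed.

Lemma is_derive_angle : is_derive angle t (sg / w_of t).
Proof.
  pose proof rho2_pos as Hr. pose proof (sqrt_lt_R0 _ Hr) as Hq.
  pose proof (pow2_sqrt _ (Rlt_le _ _ Hr)) as Eq. set (r := sqrt rho2) in *.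
  assert (Hb : -1 < x_of t / r < 1).
  { split.
    - apply (Rmult_lt_reg_r r); [exact Hq|]. unfold Rdiv. rewrite Rmult_assoc, Rinv_l by lra. nra.
    - apply (Rmult_lt_reg_r r); [exact Hq|]. unfold Rdiv. rewrite Rmult_assoc, Rinv_l by lra. nra. }
  assert (Ha : is_derive asin (x_of t / r) (/ sqrt (1 - (x_of t / r)²))).
  { apply is_derive_Reals. eapply derive_pt_eq_1. rewrite (derive_pt_asin _ Hb). unfold Rdiv; ring. }
  assert (Es : sqrt (1 - (x_of t / r)²) = sqrt (rho2 - x_of t ^ 2) / r).
  { replace (1 - (x_of t / r)²) with ((rho2 - x_of t ^ 2) / r ^ 2).
    2:{ rewrite <- Eq. unfold Rsqr. field. lra. }
    rewrite sqrt_div by nra. rewrite sqrt_pow2 by lra. reflexivity. }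
  rewrite Es in Ha.
  assert (Hc : is_derive (fun s => asin (x_of s / r)) t (scal (sg / r) (/ (sqrt (rho2 - x_of t ^ 2) / r)))).
  { apply (is_derive_comp asin (fun s => x_of s / r)); [exact Ha|].
    pose proof is_derive_x_of as Hx. derive_known. field. lra. }
  unfold angle. fold r. eapply is_derive_val; [apply is_derive_scal; exact Hc|].
  change (eps * (sg / r * / (sqrt (rho2 - x_of t ^ 2) / r)) = sg / w_of t). unfold w_of.
  assert (0 < sqrt (rho2 - x_of t ^ 2)) by (apply sqrt_lt_R0; lra).
  destruct heps as [-> | ->]; field; lra.
Qed.

Lemma is_derive_s1_of : is_derive s1_of t (- (sg * rate / w_of t * s2_of t)).
Proof. pose proof is_derive_angle as Ha. unfold s1_of, s2_of. derive_known. unfold Rdiv; ring. Qed.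

Lemma is_derive_s2_of : is_derive s2_of t (sg * rate / w_of t * s1_of t).
Proof. pose proof is_derive_angle as Ha. unfold s1_of, s2_of. derive_known. unfold Rdiv; ring. Qed.

(** [d] is a constant real multiple of [(w - i x) s]. The first factor turns at the rate [- sg / w]
    and [s] at [rate * sg / w]. *)
Lemma is_derive_d1_of : is_derive d1_of t (sg * (1 - rate) / w_of t * d2_of t).
Proof.
  pose proof is_derive_s1_of. pose proof is_derive_s2_of. pose proof is_derive_x_of.
  pose proof is_derive_w_of. pose proof w_of_neq0. unfold d1_of, d2_of. derive_known.
  field. lra.
Qed.

Lemma is_derive_d2_of : is_derive d2_of t (- (sg * (1 - rate) / w_of t * d1_of t)).
Proof.
  pose proof is_derive_s1_of. pose proof is_derive_s2_of. pose proof is_derive_x_of.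
  pose proof is_derive_w_of. pose proof w_of_neq0. unfold d1_of, d2_of. derive_known.
  field. lra.
Qed.

Lemma k_eq : 2 * k = sg ^ 2 * (J - 2 * c0) * (J + 2 * c0) / (4 * J ^ 2).
Proof. apply (Rmult_eq_reg_r (J ^ 2)); [rewrite hk; field; lra | nra]. Qed.

Lemma s_norm : s1_of t ^ 2 + s2_of t ^ 2 = 2 * J + 4 * c0.
Proof.
  rewrite <- hs0. unfold s1_of, s2_of. pose proof (sin2_cos2 (rate * angle t)) as E. unfold Rsqr in E.
  set (c := cos _) in *. set (s := sin _) in *.
  transitivity ((s * s + c * c) * (s01 ^ 2 + s02 ^ 2)); [ring | rewrite E; ring].
Qed.

Lemma d_norm : d1_of t ^ 2 + d2_of t ^ 2 = 2 * J - 4 * c0.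
Proof.
  unfold d1_of, d2_of.
  transitivity (16 * (w_of t ^ 2 + x_of t ^ 2) * (s1_of t ^ 2 + s2_of t ^ 2) / (2 * J + 4 * c0) ^ 2);
    [field; lra|].
  rewrite s_norm, w_of_sqr. unfold rho2. field. lra.
Qed.

Lemma s_dot_d : s1_of t * d1_of t + s2_of t * d2_of t = - 4 * w_of t.
Proof.
  unfold d1_of, d2_of.
  transitivity (- 4 * w_of t * (s1_of t ^ 2 + s2_of t ^ 2) / (2 * J + 4 * c0)); [field; lra|].
  rewrite s_norm. field. lra.
Qed.

(** The definition of [d] from [s], inverted: the roles can be exchanged because
    [16 (w^2 + x^2) = |s|^2 |d|^2]. *)
Lemma s1_eq : s1_of t = - 4 * (w_of t * d1_of t - x_of t * d2_of t) / (2 * J - 4 * c0).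
Proof.
  unfold d1_of, d2_of.
  transitivity (16 * (w_of t ^ 2 + x_of t ^ 2) * s1_of t / ((2 * J + 4 * c0) * (2 * J - 4 * c0)));
    [rewrite w_of_sqr; unfold rho2; field; lra | field; lra].
Qed.

Lemma s2_eq : s2_of t = - 4 * (w_of t * d2_of t + x_of t * d1_of t) / (2 * J - 4 * c0).
Proof.
  unfold d1_of, d2_of.
  transitivity (16 * (w_of t ^ 2 + x_of t ^ 2) * s2_of t / ((2 * J + 4 * c0) * (2 * J - 4 * c0)));
    [rewrite w_of_sqr; unfold rho2; field; lra | field; lra].
Qed.

(** The right side is the force carried over to [s], [d] by [force_unspin]. A uniform change of
    argument would not match it: the varying rate [1 / w] supplies the tangential part, and [hk]
    adjusts the constant. *)
Lemma is_derive_ds1 :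
  is_derive (fun t => - (sg * rate / w_of t * s2_of t)) t
    (2 * k / w_of t ^ 2 * (s1_of t + J / w_of t * d1_of t)).
Proof.
  pose proof is_derive_s2_of. pose proof is_derive_w_of. pose proof w_of_neq0 as Hw. derive_known.
  - simpl. tauto.
  - rewrite k_eq. unfold d1_of, rate. field. lra.
Qed.

Lemma is_derive_ds2 :
  is_derive (fun t => sg * rate / w_of t * s1_of t) t
    (2 * k / w_of t ^ 2 * (s2_of t + J / w_of t * d2_of t)).
Proof.
  pose proof is_derive_s1_of. pose proof is_derive_w_of. pose proof w_of_neq0 as Hw. derive_known.
  - simpl. tauto.
  - rewrite k_eq. unfold d2_of, rate. field. lra.
Qed.

Lemma is_derive_dd1 :
  is_derive (fun t => sg * (1 - rate) / w_of t * d2_of t) t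
    (2 * k / w_of t ^ 2 * (d1_of t + J / w_of t * s1_of t)).
Proof.
  pose proof is_derive_d2_of. pose proof is_derive_w_of. pose proof w_of_neq0 as Hw. derive_known.
  - simpl. tauto.
  - rewrite k_eq, s1_eq. unfold rate. field. lra.
Qed.

Lemma is_derive_dd2 :
  is_derive (fun t => - (sg * (1 - rate) / w_of t * d1_of t)) t
    (2 * k / w_of t ^ 2 * (d2_of t + J / w_of t * s2_of t)).
Proof.
  pose proof is_derive_d1_of. pose proof is_derive_w_of. pose proof w_of_neq0 as Hw. derive_known.
  - simpl. tauto.
  - rewrite k_eq, s2_eq. unfold rate. field. lra.
Qed.

End AtTime.

Definition Z1_of (t : R) : C := unspin1 n1 n2 (s1_of t) (s2_of t) (d1_of t) (d2_of t).
Definition Z2_of (t : R) : C := unspin2 n1 n2 (s1_of t) (s2_of t) (d1_of t) (d2_of t).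

Definition U1_of (t : R) : C := unspin1 n1 n2
  (- (sg * rate / w_of t * s2_of t)) (sg * rate / w_of t * s1_of t)
  (sg * (1 - rate) / w_of t * d2_of t) (- (sg * (1 - rate) / w_of t * d1_of t)).
Definition U2_of (t : R) : C := unspin2 n1 n2
  (- (sg * rate / w_of t * s2_of t)) (sg * rate / w_of t * s1_of t)
  (sg * (1 - rate) / w_of t * d2_of t) (- (sg * (1 - rate) / w_of t * d1_of t)).

Lemma is_derive_unspin1 (f1 f2 g1 g2 : R -> R) (t f1' f2' g1' g2' : R) :
  is_derive f1 t f1' -> is_derive f2 t f2' -> is_derive g1 t g1' -> is_derive g2 t g2' ->
  is_derive (fun s => unspin1 n1 n2 (f1 s) (f2 s) (g1 s) (g2 s)) t (unspin1 n1 n2 f1' f2' g1' g2').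
Proof. intros. apply is_derive_C_iff; split; unfold unspin1, Re, Im; simpl; derive_known; field. Qed.

Lemma is_derive_unspin2 (f1 f2 g1 g2 : R -> R) (t f1' f2' g1' g2' : R) :
  is_derive f1 t f1' -> is_derive f2 t f2' -> is_derive g1 t g1' -> is_derive g2 t g2' ->
  is_derive (fun s => unspin2 n1 n2 (f1 s) (f2 s) (g1 s) (g2 s)) t (unspin2 n1 n2 f1' f2' g1' g2').
Proof. intros. apply is_derive_C_iff; split; unfold unspin2, Re, Im; simpl; derive_known; field. Qed.

Lemma norm2_unspin (s1 s2 d1 d2 : R) :
  norm2 (unspin1 n1 n2 s1 s2 d1 d2) (unspin2 n1 n2 s1 s2 d1 d2) =
  (s1 ^ 2 + s2 ^ 2 + d1 ^ 2 + d2 ^ 2) / 4.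
Proof.
  unfold norm2, unspin1, unspin2, Re, Im; cbn [fst snd].
  transitivity (((s1 + d1) ^ 2 + (s2 + d2) ^ 2
    + (n1 ^ 2 + n2 ^ 2) * ((s1 - d1) ^ 2 + (s2 - d2) ^ 2)) / 8); [field | rewrite hn; field].
Qed.

Lemma wedge_unspin (s1 s2 d1 d2 : R) :
  wedge (unspin1 n1 n2 s1 s2 d1 d2) (unspin2 n1 n2 s1 s2 d1 d2) = - (s1 * d1 + s2 * d2) / 4.
Proof.
  unfold wedge, unspin1, unspin2, Re, Im; cbn [fst snd Cmult Cconj].
  transitivity ((- (s1 + d1) ^ 2 - (s2 + d2) ^ 2
    + (n1 ^ 2 + n2 ^ 2) * ((s1 - d1) ^ 2 + (s2 - d2) ^ 2)) / 16); [field | rewrite hn; field].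
Qed.

(** In these variables the inertia is [(|s|^2 + |d|^2) / 4] and [w3] is minus a quarter of the dot
    product of [s] and [d]. The gradient of [w3] thus exchanges [s] and [d] up to a factor. *)
Lemma force_unspin (w s1 s2 d1 d2 : R) : w <> 0 ->
  norm2 (unspin1 n1 n2 s1 s2 d1 d2) (unspin2 n1 n2 s1 s2 d1 d2) = J ->
  wedge (unspin1 n1 n2 s1 s2 d1 d2) (unspin2 n1 n2 s1 s2 d1 d2) = w ->
  let S1 := 2 * k / w ^ 2 * (s1 + J / w * d1) in
  let S2 := 2 * k / w ^ 2 * (s2 + J / w * d2) in
  let D1 := 2 * k / w ^ 2 * (d1 + J / w * s1) in
  let D2 := 2 * k / w ^ 2 * (d2 + J / w * s2) in
  unspin1 n1 n2 S1 S2 D1 D2 =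
    force1 k (unspin1 n1 n2 s1 s2 d1 d2) (unspin2 n1 n2 s1 s2 d1 d2) /\
  unspin2 n1 n2 S1 S2 D1 D2 =
    force2 k (unspin1 n1 n2 s1 s2 d1 d2) (unspin2 n1 n2 s1 s2 d1 d2).
Proof.
  intros Hw EJ Ew S1 S2 D1 D2. unfold force1, force2. rewrite EJ, Ew.
  unfold S1, S2, D1, D2, unspin1, unspin2, Re, Im; cbn [fst snd].
  split; apply injective_projections; cbn [fst snd]; field; exact Hw.
Qed.

Lemma norm2_of (t : R) : x_of t ^ 2 < rho2 -> norm2 (Z1_of t) (Z2_of t) = J.
Proof.
  intros Ht. unfold Z1_of, Z2_of. rewrite norm2_unspin.
  pose proof (s_norm t). pose proof (d_norm t Ht). lra.
Qed.

Lemma wedge_of (t : R) : wedge (Z1_of t) (Z2_of t) = w_of t.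
Proof. unfold Z1_of, Z2_of. rewrite wedge_unspin, s_dot_d. field. Qed.

Lemma explicit_dynamics (t : R) : x_of t ^ 2 < rho2 ->
  is_derive Z1_of t (U1_of t) /\ is_derive Z2_of t (U2_of t) /\
  is_derive U1_of t (force1 k (Z1_of t) (Z2_of t)) /\
  is_derive U2_of t (force2 k (Z1_of t) (Z2_of t)).
Proof.
  intros Ht.
  destruct (force_unspin (w_of t) (s1_of t) (s2_of t) (d1_of t) (d2_of t)
    (w_of_neq0 t Ht) (norm2_of t Ht) (wedge_of t)) as [F1 F2].
  change (unspin1 n1 n2 (s1_of t) (s2_of t) (d1_of t) (d2_of t)) with (Z1_of t) in F1, F2.
  change (unspin2 n1 n2 (s1_of t) (s2_of t) (d1_of t) (d2_of t)) with (Z2_of t) in F1, F2.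
  rewrite <- F1, <- F2.
  split; [|split; [|split]].
  - apply is_derive_unspin1; [apply is_derive_s1_of | apply is_derive_s2_of
      | apply is_derive_d1_of | apply is_derive_d2_of]; exact Ht.
  - apply is_derive_unspin2; [apply is_derive_s1_of | apply is_derive_s2_of
      | apply is_derive_d1_of | apply is_derive_d2_of]; exact Ht.
  - apply is_derive_unspin1; [apply is_derive_ds1 | apply is_derive_ds2
      | apply is_derive_dd1 | apply is_derive_dd2]; exact Ht.
  - apply is_derive_unspin2; [apply is_derive_ds1 | apply is_derive_ds2
      | apply is_derive_dd1 | apply is_derive_dd2]; exact Ht.
Qed.

(** The only condition on time is [x_of t ^ 2 < rho2], which is what lets this motion serve as an
    extension. The barycenter rests at [G], hence the [0] in the velocities. *)
Lemma explicit_newton (m : body -> R) (gamma : R) (G : C) (t : R) :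
  (forall i, 0 < m i) -> strength m gamma = k -> x_of t ^ 2 < rho2 ->
  let q s := of_jacobi m G (Z1_of s) (Z2_of s) in
  let v s := of_jacobi m 0 (U1_of s) (U2_of s) in
  signed_area (q t) <> 0 /\
  forall i, is_derive (fun s => q s i) t (v t i) /\
    exists acc : C, is_derive (fun s => v s i) t acc /\
      (RtoC (m i) * acc = - grad_body (potential m gamma) i (q t))%C.
Proof.
  intros hm Ek Ht q v.
  destruct (explicit_dynamics t Ht) as (H1 & H2 & H3 & H4).
  apply is_derive_C_iff in H1, H2, H3, H4.
  assert (Ha : signed_area (q t) <> 0).
  { intros E. pose proof (wedge_jacobi m hm (q t)) as Hw. rewrite E in Hw.
    unfold q in Hw. rewrite jacobi1_of_jacobi, jacobi2_of_jacobi, wedge_of in Hw by exact hm.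
    apply (w_of_neq0 t Ht). lra. }
  assert (Hlin : forall (G' : C) (f g : R -> C) (f' g' : C) i,
    is_derive (fun s => Re (f s)) t (Re f') /\ is_derive (fun s => Im (f s)) t (Im f') ->
    is_derive (fun s => Re (g s)) t (Re g') /\ is_derive (fun s => Im (g s)) t (Im g') ->
    is_derive (fun s => of_jacobi m G' (f s) (g s) i) t (of_jacobi m 0 f' g' i)).
  { intros G' f g f' g' i [Hf1 Hf2] [Hg1 Hg2]. apply is_derive_C_iff. split.
    - rewrite of_jacobi_re. eapply is_derive_ext; [intros s; symmetry; apply of_jacobi_re|].
      exact (is_derive_affine2 _ _ _ _ _ _ _ _ Hf1 Hg1).
    - rewrite of_jacobi_im. eapply is_derive_ext; [intros s; symmetry; apply of_jacobi_im|].
      exact (is_derive_affine2 _ _ _ _ _ _ _ _ Hf2 Hg2). }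
  split; [exact Ha|]. intros i. split; [apply Hlin; assumption|].
  exists (of_jacobi m 0 (force1 k (Z1_of t) (Z2_of t)) (force2 k (Z1_of t) (Z2_of t)) i).
  split; [apply Hlin; assumption|].
  rewrite <- (newton_force m hm gamma (q t) i Ha), Ek. unfold q.
  rewrite jacobi1_of_jacobi, jacobi2_of_jacobi by exact hm. reflexivity.
Qed.

End Explicit.

(** * The shape moves on a chord at constant velocity *)

Section Reduced.

Variables (a b : Rbar) (k J : R) (p1 p2 p3 p4 u1 u2 u3 u4 : R -> R).

Let w t := p1 t * p4 t - p2 t * p3 t.

Hypotheses
  (hw : forall t, inside a b t -> w t <> 0)
  (hp1 : forall t, inside a b t -> is_derive p1 t (u1 t))
  (hp2 : forall t, inside a b t -> is_derive p2 t (u2 t))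
  (hp3 : forall t, inside a b t -> is_derive p3 t (u3 t))
  (hp4 : forall t, inside a b t -> is_derive p4 t (u4 t))
  (hu1 : forall t, inside a b t -> is_derive u1 t (2 * k / w t ^ 2 * (p1 t - J / w t * p4 t)))
  (hu2 : forall t, inside a b t -> is_derive u2 t (2 * k / w t ^ 2 * (p2 t + J / w t * p3 t)))
  (hu3 : forall t, inside a b t -> is_derive u3 t (2 * k / w t ^ 2 * (p3 t + J / w t * p2 t)))
  (hu4 : forall t, inside a b t -> is_derive u4 t (2 * k / w t ^ 2 * (p4 t - J / w t * p1 t)))
  (hJ : forall t, inside a b t -> p1 t ^ 2 + p2 t ^ 2 + p3 t ^ 2 + p4 t ^ 2 = J)
  (hdot : forall t, inside a b t -> p1 t * u1 t + p2 t * u2 t + p3 t * u3 t + p4 t * u4 t = 0)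
  (hang : forall t, inside a b t -> p1 t * u2 t - p2 t * u1 t + (p3 t * u4 t - p4 t * u3 t) = 0)
  (hen : forall t, inside a b t ->
     u1 t ^ 2 + u2 t ^ 2 + u3 t ^ 2 + u4 t ^ 2 = 2 * k * J / w t ^ 2).

(** [J - 2 w] and [J + 2 w] are sums of two squares, so [J >= 2 |w| > 0]. *)
Lemma J_pos (t : R) : inside a b t -> 0 < J.
Proof.
  intros Ht. rewrite <- (hJ t Ht). pose proof (hw t Ht) as H. unfold w in H.
  assert (0 <= (p1 t - p4 t) ^ 2) by apply pow2_ge_0.
  assert (0 <= (p1 t + p4 t) ^ 2) by apply pow2_ge_0.
  assert (0 <= (p2 t + p3 t) ^ 2) by apply pow2_ge_0.
  assert (0 <= (p2 t - p3 t) ^ 2) by apply pow2_ge_0.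
  nra.
Qed.

(** Vanishing [J] and [dI/dt] mean that the velocity [(Z1', Z2')] is Hermitian
    orthogonal to [(Z1, Z2)], hence a complex multiple [l] of [(-conj Z2, conj Z1)]. *)
Lemma horizontal_velocity (t : R) : inside a b t -> exists l1 l2,
  u1 t = - (l1 * p3 t + l2 * p4 t) /\ u2 t = - (l2 * p3 t - l1 * p4 t) /\
  u3 t = l1 * p1 t + l2 * p2 t /\ u4 t = l2 * p1 t - l1 * p2 t /\
  l1 ^ 2 + l2 ^ 2 = 2 * k / w t ^ 2.
Proof.
  intros Ht. pose proof (J_pos t Ht) as HJ. pose proof (hw t Ht) as Hw.
  pose proof (hJ t Ht) as EJ. pose proof (hdot t Ht) as Ed. pose proof (hang t Ht) as Ea.
  pose proof (hen t Ht) as Ee.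
  (* [l = (Z1 Z2' - Z2 Z1') / J] is the component of the velocity along [(- conj Z2, conj Z1)],
     whose squared norm is [J]. In [E1] to [E4], [Ed] and [Ea] remove the component along
     [(Z1, Z2)]. *)
  set (l1 := (p1 t * u3 t - p2 t * u4 t - (p3 t * u1 t - p4 t * u2 t)) / J).
  set (l2 := (p1 t * u4 t + p2 t * u3 t - (p3 t * u2 t + p4 t * u1 t)) / J).
  exists l1, l2.
  assert (E1 : u1 t = - (l1 * p3 t + l2 * p4 t)).
  { apply (Rmult_eq_reg_l J); [|lra]. unfold l1, l2. field_simplify; [|lra].
    clear - EJ Ed Ea. rewrite <- EJ.
    transitivity ((p1 t ^ 2 + p2 t ^ 2 + p3 t ^ 2 + p4 t ^ 2) * u1 t
      - p1 t * (p1 t * u1 t + p2 t * u2 t + p3 t * u3 t + p4 t * u4 t)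
      + p2 t * (p1 t * u2 t - p2 t * u1 t + (p3 t * u4 t - p4 t * u3 t)));
    [rewrite Ed, Ea; ring | ring]. }
  assert (E2 : u2 t = - (l2 * p3 t - l1 * p4 t)).
  { apply (Rmult_eq_reg_l J); [|lra]. unfold l1, l2. field_simplify; [|lra].
    clear - EJ Ed Ea. rewrite <- EJ.
    transitivity ((p1 t ^ 2 + p2 t ^ 2 + p3 t ^ 2 + p4 t ^ 2) * u2 t
      - p2 t * (p1 t * u1 t + p2 t * u2 t + p3 t * u3 t + p4 t * u4 t)
      - p1 t * (p1 t * u2 t - p2 t * u1 t + (p3 t * u4 t - p4 t * u3 t)));
    [rewrite Ed, Ea; ring | ring]. }
  assert (E3 : u3 t = l1 * p1 t + l2 * p2 t).
  { apply (Rmult_eq_reg_l J); [|lra]. unfold l1, l2. field_simplify; [|lra].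
    clear - EJ Ed Ea. rewrite <- EJ.
    transitivity ((p1 t ^ 2 + p2 t ^ 2 + p3 t ^ 2 + p4 t ^ 2) * u3 t
      - p3 t * (p1 t * u1 t + p2 t * u2 t + p3 t * u3 t + p4 t * u4 t)
      + p4 t * (p1 t * u2 t - p2 t * u1 t + (p3 t * u4 t - p4 t * u3 t)));
    [rewrite Ed, Ea; ring | ring]. }
  assert (E4 : u4 t = l2 * p1 t - l1 * p2 t).
  { apply (Rmult_eq_reg_l J); [|lra]. unfold l1, l2. field_simplify; [|lra].
    clear - EJ Ed Ea. rewrite <- EJ.
    transitivity ((p1 t ^ 2 + p2 t ^ 2 + p3 t ^ 2 + p4 t ^ 2) * u4 t
      - p4 t * (p1 t * u1 t + p2 t * u2 t + p3 t * u3 t + p4 t * u4 t)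
      - p3 t * (p1 t * u2 t - p2 t * u1 t + (p3 t * u4 t - p4 t * u3 t)));
    [rewrite Ed, Ea; ring | ring]. }
  repeat split; try assumption.
  apply (Rmult_eq_reg_r J); [|lra].
  transitivity (u1 t ^ 2 + u2 t ^ 2 + u3 t ^ 2 + u4 t ^ 2);
    [rewrite E1, E2, E3, E4, <- EJ; ring | rewrite Ee; field; exact Hw].
Qed.

Let W1 t := / 2 * (p1 t ^ 2 + p2 t ^ 2 - p3 t ^ 2 - p4 t ^ 2).
Let W2 t := p1 t * p3 t + p2 t * p4 t.
Let B1 t := p1 t * u1 t + p2 t * u2 t - p3 t * u3 t - p4 t * u4 t.
Let B2 t := u1 t * p3 t + p1 t * u3 t + u2 t * p4 t + p2 t * u4 t.
Let dw t := u1 t * p4 t + p1 t * u4 t - u2 t * p3 t - p2 t * u3 t.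

Ltac derive_on Ht :=
  auto_derive;
  [repeat split;
   match goal with |- ex_derive (fun x => ?f x) _ =>
     match goal with H : forall t, _ -> is_derive f t _ |- _ => eexists; exact (H _ Ht) end end
  | repeat match goal with |- context [Derive (fun x => ?f x) _] =>
     match goal with H : forall t, _ -> is_derive f t _ |- _ =>
       rewrite (Derive_eta f _ _ (H _ Ht)) end end].

Lemma is_derive_W1 (t : R) : inside a b t -> is_derive W1 t (B1 t).
Proof. intros Ht. unfold W1. derive_on Ht. unfold B1; field. Qed.

Lemma is_derive_W2 (t : R) : inside a b t -> is_derive W2 t (B2 t).
Proof. intros Ht. unfold W2. derive_on Ht. unfold B2; ring. Qed.

Lemma is_derive_w (t : R) : inside a b t -> is_derive w t (dw t).
Proof. intros Ht. unfold w. derive_on Ht. unfold dw; ring. Qed.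

(** Horizontality makes the kinetic part of [w1''] equal to [|l|^2 (|Z2|^2 - |Z1|^2)]. The force
    part is the same expression with [- 2 k / w^2] in place of [|l|^2], and zero energy says that
    the two cancel. The computation for [w2''] is analogous. *)
Lemma is_derive_B1 (t : R) : inside a b t -> is_derive B1 t 0.
Proof.
  intros Ht. unfold B1. derive_on Ht.
  pose proof (hw t Ht) as Hw. pose proof (hJ t Ht) as EJ.
  destruct (horizontal_velocity t Ht) as (l1 & l2 & E1 & E2 & E3 & E4 & El).
  transitivity ((p3 t ^ 2 + p4 t ^ 2 - p1 t ^ 2 - p2 t ^ 2) * (l1 ^ 2 + l2 ^ 2 - 2 * k / w t ^ 2));
    [|rewrite El; ring].
  rewrite E1, E2, E3, E4. unfold w in *. field. exact Hw.
Qed.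

Lemma is_derive_B2 (t : R) : inside a b t -> is_derive B2 t 0.
Proof.
  intros Ht. unfold B2. derive_on Ht.
  pose proof (hw t Ht) as Hw. pose proof (hJ t Ht) as EJ.
  destruct (horizontal_velocity t Ht) as (l1 & l2 & E1 & E2 & E3 & E4 & El).
  transitivity (- 2 * W2 t * (l1 ^ 2 + l2 ^ 2 - 2 * k / w t ^ 2));
    [|rewrite El; ring].
  rewrite E1, E2, E3, E4. unfold W2, w in *. field. exact Hw.
Qed.

Lemma sphere (t : R) : inside a b t -> W1 t ^ 2 + W2 t ^ 2 + w t ^ 2 = / 4 * J ^ 2.
Proof. intros Ht. rewrite <- (hJ t Ht). unfold W1, W2, w. field. Qed.

(** On horizontal vectors the shape projection multiplies squared lengths by [J], and the energy
    fixes the length of the velocity. *)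
Lemma shape_speed (t : R) : inside a b t ->
  B1 t ^ 2 + B2 t ^ 2 + dw t ^ 2 = 2 * k * J ^ 2 / w t ^ 2.
Proof.
  intros Ht. pose proof (hJ t Ht) as EJ.
  destruct (horizontal_velocity t Ht) as (l1 & l2 & E1 & E2 & E3 & E4 & El).
  transitivity (J ^ 2 * (2 * k / w t ^ 2)); [|unfold Rdiv; ring].
  rewrite <- El, <- EJ. unfold B1, B2, dw. rewrite E1, E2, E3, E4. ring.
Qed.

Lemma shape_tangent (t : R) : inside a b t -> W1 t * B1 t + W2 t * B2 t + w t * dw t = 0.
Proof.
  intros Ht.
  destruct (horizontal_velocity t Ht) as (l1 & l2 & E1 & E2 & E3 & E4 & _).
  unfold W1, W2, w, B1, B2, dw. rewrite E1, E2, E3, E4. field.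
Qed.

(** The constant velocity of [w1 + i w2] is written [sg * i n]; then [C] and [x] are the components
    of the point along [n] and [i n]. *)
Lemma shape_affine (t0 : R) : 0 < k -> inside a b t0 ->
  exists n1 n2 C sg x0,
    n1 ^ 2 + n2 ^ 2 = 1 /\ 0 < sg /\ 2 * k * J ^ 2 = sg ^ 2 * (/ 4 * J ^ 2 - C ^ 2) /\
    forall t, inside a b t ->
      let x := x0 + sg * (t - t0) in
      W1 t = n1 * C - n2 * x /\ W2 t = n2 * C + n1 * x /\
      w t ^ 2 = / 4 * J ^ 2 - C ^ 2 - x ^ 2 /\
      B1 t = - n2 * sg /\ B2 t = n1 * sg.
Proof.
  intros Hk Ht0. pose proof (J_pos t0 Ht0) as HJ. pose proof (hw t0 Ht0) as Hw.
  pose proof (shape_speed t0 Ht0) as Hs. pose proof (shape_tangent t0 Ht0) as Htan.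
  (* The chart velocity cannot vanish: by tangency to the sphere [w'] would vanish too, against the
     positive speed in [Hs]. *)
  assert (Hpos : 0 < B1 t0 ^ 2 + B2 t0 ^ 2).
  { assert (0 < 2 * k * J ^ 2 / w t0 ^ 2).
    { apply Rdiv_lt_0_compat; [|apply pow2_gt_0; exact Hw].
      apply Rmult_lt_0_compat; [lra | apply pow_lt; exact HJ]. }
    destruct (Rle_lt_or_eq_dec 0 (B1 t0 ^ 2 + B2 t0 ^ 2)) as [L | L]; [nra | exact L |].
    exfalso. assert (B1 t0 = 0) by nra. assert (B2 t0 = 0) by nra.
    assert (E : w t0 * dw t0 = 0) by nra. apply Rmult_integral in E.
    destruct E as [E | E]; [exact (Hw E)|]. rewrite E in Hs. nra. }
  set (sg := sqrt (B1 t0 ^ 2 + B2 t0 ^ 2)).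
  assert (Hsg : 0 < sg) by (apply sqrt_lt_R0; exact Hpos).
  assert (Esg : sg ^ 2 = B1 t0 ^ 2 + B2 t0 ^ 2) by (apply pow2_sqrt; lra).
  clearbody sg.
  assert (En : (B2 t0 / sg) ^ 2 + (- B1 t0 / sg) ^ 2 = 1).
  { transitivity ((B1 t0 ^ 2 + B2 t0 ^ 2) / sg ^ 2); [field; lra|]. rewrite <- Esg. field; lra. }
  set (n1 := B2 t0 / sg) in *. set (n2 := - B1 t0 / sg) in *.
  assert (EB1 : B1 t0 = - n2 * sg) by (unfold n2; field; lra).
  assert (EB2 : B2 t0 = n1 * sg) by (unfold n1; field; lra).
  clearbody n1 n2.
  set (C := n1 * W1 t0 + n2 * W2 t0). set (x0 := n1 * W2 t0 - n2 * W1 t0).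
  exists n1, n2, C, sg, x0.
  assert (F1 : W1 t0 = n1 * C - n2 * x0).
  { transitivity ((n1 ^ 2 + n2 ^ 2) * W1 t0); [rewrite En; ring | unfold C, x0; ring]. }
  assert (F2 : W2 t0 = n2 * C + n1 * x0).
  { transitivity ((n1 ^ 2 + n2 ^ 2) * W2 t0); [rewrite En; ring | unfold C, x0; ring]. }
  clearbody C x0.
  assert (CB1 : forall t, inside a b t -> B1 t = - n2 * sg).
  { intros t Ht. rewrite <- EB1. apply (constant_on_interval a b B1 is_derive_B1); assumption. }
  assert (CB2 : forall t, inside a b t -> B2 t = n1 * sg).
  { intros t Ht. rewrite <- EB2. apply (constant_on_interval a b B2 is_derive_B2); assumption. }
  assert (CW1 : forall t, inside a b t -> W1 t = n1 * C - n2 * (x0 + sg * (t - t0))).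
  { intros t Ht. rewrite (affine_on_interval a b W1 (- n2 * sg)) with (s := t0) (t := t);
      [rewrite F1; ring | | assumption | assumption].
    intros u Hu. rewrite <- (CB1 u Hu). apply is_derive_W1; exact Hu. }
  assert (CW2 : forall t, inside a b t -> W2 t = n2 * C + n1 * (x0 + sg * (t - t0))).
  { intros t Ht. rewrite (affine_on_interval a b W2 (n1 * sg)) with (s := t0) (t := t);
      [rewrite F2; ring | | assumption | assumption].
    intros u Hu. rewrite <- (CB2 u Hu). apply is_derive_W2; exact Hu. }
  assert (Cw : forall t, inside a b t -> w t ^ 2 = / 4 * J ^ 2 - C ^ 2 - (x0 + sg * (t - t0)) ^ 2).
  { intros t Ht. rewrite <- (sphere t Ht), (CW1 t Ht), (CW2 t Ht).
    generalize (x0 + sg * (t - t0)); intros x.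
    transitivity ((n1 ^ 2 + n2 ^ 2) * (C ^ 2 + x ^ 2) + w t ^ 2 - C ^ 2 - x ^ 2);
      [rewrite En; ring | ring]. }
  repeat split; try assumption; try (intros; apply Cw || apply CW1 || apply CW2 || apply CB1 || apply CB2; assumption).
  (* The relation between [k] and [sg] is the speed formula times [w^2], evaluated at [t0] with
     [w w' = - x sg]. *)
  pose proof (Cw t0 Ht0) as E0. replace (x0 + sg * (t0 - t0)) with x0 in E0 by ring.
  assert (Ex : w t0 * dw t0 = - (x0 * sg)).
  { enough (W1 t0 * B1 t0 + W2 t0 * B2 t0 = x0 * sg) by lra.
    rewrite F1, F2, EB1, EB2. transitivity ((n1 ^ 2 + n2 ^ 2) * (x0 * sg)); [ring | rewrite En; ring]. }
  assert (Es : (B1 t0 ^ 2 + B2 t0 ^ 2) * w t0 ^ 2 + (w t0 * dw t0) ^ 2 = 2 * k * J ^ 2).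
  { transitivity ((B1 t0 ^ 2 + B2 t0 ^ 2 + dw t0 ^ 2) * w t0 ^ 2); [ring|].
    rewrite Hs. field. exact Hw. }
  rewrite <- Es, <- Esg, Ex, E0. ring.
Qed.

Lemma reduced_explicit (t0 : R) : 0 < k -> inside a b t0 ->
  exists c0 sg x0 eps n1 n2 s01 s02,
    0 < J + 2 * c0 /\ 0 < J - 2 * c0 /\ 0 < sg /\ (eps = 1 \/ eps = -1) /\
    2 * k * J ^ 2 = sg ^ 2 * (/ 4 * J ^ 2 - c0 ^ 2) /\ n1 ^ 2 + n2 ^ 2 = 1 /\
    s01 ^ 2 + s02 ^ 2 = 2 * J + 4 * c0 /\
    forall t, inside a b t ->
      x_of sg x0 t0 t ^ 2 < rho2 J c0 /\
      W1 t = n1 * c0 - n2 * x_of sg x0 t0 t /\ W2 t = n2 * c0 + n1 * x_of sg x0 t0 t /\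
      w t = w_of J c0 sg x0 t0 eps t /\
      (p1 t, p2 t) = Z1_of J c0 sg x0 t0 eps n1 n2 s01 s02 t /\
      (p3 t, p4 t) = Z2_of J c0 sg x0 t0 eps n1 n2 s01 s02 t.
Proof.
  intros Hk Ht0. pose proof (J_pos t0 Ht0) as HJ.
  destruct (shape_affine t0 Hk Ht0) as (n1 & n2 & c0 & sg & x0 & En & Hsg & Ek & Haff).
  cbv zeta in Haff.
  destruct (constant_sign a b w) as (eps & Heps & Hsign).
  { intros t Ht. apply (ex_derive_continuous w t). eexists. apply is_derive_w; exact Ht. }
  { exact hw. }
  assert (Hx : forall t, inside a b t -> x_of sg x0 t0 t ^ 2 < rho2 J c0).
  { intros t Ht. destruct (Haff t Ht) as (_ & _ & Ew & _). unfold x_of, rho2.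
    assert (0 < w t ^ 2) by (apply pow2_gt_0, hw, Ht). lra. }
  assert (Hw : forall t, inside a b t -> w t = w_of J c0 sg x0 t0 eps t).
  { intros t Ht. destruct (Haff t Ht) as (_ & _ & Ew & _). specialize (Hsign t Ht).
    unfold w_of. replace (rho2 J c0 - x_of sg x0 t0 t ^ 2) with ((eps * w t) ^ 2).
    - rewrite sqrt_pow2 by lra. destruct Heps as [-> | ->]; ring.
    - unfold rho2, x_of. rewrite Rpow_mult_distr, Ew. destruct Heps as [-> | ->]; ring. }
  (* The chord meets the open disc, so [4 * c0 ^ 2 < J ^ 2]; with [J > 0] both factors are
     positive. *)
  assert (HC : (J + 2 * c0) * (J - 2 * c0) > 0).
  { specialize (Hx t0 Ht0). unfold rho2 in Hx. pose proof (pow2_ge_0 (x_of sg x0 t0 t0)). nra. }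
  assert (HS : 0 < J + 2 * c0) by nra. assert (HD : 0 < J - 2 * c0) by nra.
  set (s1 := fun t => p1 t - p4 t + (n1 * (p1 t + p4 t) - n2 * (p2 t - p3 t))).
  set (s2 := fun t => p2 t + p3 t + (n2 * (p1 t + p4 t) + n1 * (p2 t - p3 t))).
  assert (Hspin := fun t Ht => match Haff t Ht with
    conj E1 (conj E2 (conj _ (conj E3 E4))) =>
      spinor_velocity J c0 sg (x_of sg x0 t0 t) n1 n2 (p1 t) (p2 t) (p3 t) (p4 t)
        (u1 t) (u2 t) (u3 t) (u4 t) (hw t Ht) HJ HS HD En (hJ t Ht) (hdot t Ht) (hang t Ht)
        E1 E2 E3 E4 end).
  cbv zeta in Hspin.
  (* The rate of rotation of [s] is now a known function of time with a known primitive, so [s] is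
     explicit up to the two constants. *)
  destruct (rotation_solution a b s1 s2
    (fun t => rate J c0 * angle J c0 sg x0 t0 eps t) (fun t => sg * rate J c0 / w t))
    as (s01 & s02 & Hrot).
  { intros t Ht. rewrite (Hw t Ht).
    eapply is_derive_val; [apply is_derive_scal, is_derive_angle; try assumption; apply Hx, Ht|].
    unfold Rdiv; ring. }
  { intros t Ht. destruct (Hspin t Ht) as (_ & _ & _ & E & _).
    eapply is_derive_val; [|exact E]. unfold s1. derive_on Ht. ring. }
  { intros t Ht. destruct (Hspin t Ht) as (_ & _ & _ & _ & E).
    eapply is_derive_val; [|exact E]. unfold s2. derive_on Ht. ring. }
  exists c0, sg, x0, eps, n1, n2, s01, s02.
  assert (Es : forall t, inside a b t -> s1 t = s1_of J c0 sg x0 t0 eps s01 s02 t /\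
      s2 t = s2_of J c0 sg x0 t0 eps s01 s02 t) by exact Hrot.
  do 6 (split; [assumption|]). split.
  - destruct (Hspin t0 Ht0) as (E & _). fold (s1 t0) (s2 t0) in E. rewrite <- E.
    destruct (Hrot t0 Ht0) as [-> ->]. set (z := rate J c0 * _).
    pose proof (sin2_cos2 z) as Ez. unfold Rsqr in Ez.
    transitivity ((sin z * sin z + cos z * cos z) * (s01 ^ 2 + s02 ^ 2)); [rewrite Ez; ring | ring].
  - intros t Ht. destruct (Haff t Ht) as (E1 & E2 & _).
    split; [apply Hx, Ht|]. split; [exact E1|]. split; [exact E2|]. split; [apply Hw, Ht|].
    destruct (Hspin t Ht) as (_ & Ed1 & Ed2 & _). fold (s1 t) (s2 t) in Ed1, Ed2.
    destruct (Es t Ht) as [Es1 Es2].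
    change (p1 t * p4 t - p2 t * p3 t) with (w t) in Ed1, Ed2.
    assert (F1 : d1_of J c0 sg x0 t0 eps s01 s02 t
      = p1 t - p4 t - (n1 * (p1 t + p4 t) - n2 * (p2 t - p3 t))).
    { unfold d1_of. rewrite Ed1, <- Es1, <- Es2, <- (Hw t Ht). reflexivity. }
    assert (F2 : d2_of J c0 sg x0 t0 eps s01 s02 t
      = p2 t + p3 t - (n2 * (p1 t + p4 t) + n1 * (p2 t - p3 t))).
    { unfold d2_of. rewrite Ed2, <- Es1, <- Es2, <- (Hw t Ht). reflexivity. }
    unfold Z1_of, Z2_of. rewrite F1, F2, <- Es1, <- Es2. unfold s1, s2, unspin1, unspin2.
    split; apply injective_projections; cbn [fst snd].
    + transitivity ((2 * (p1 t - p4 t) + 2 * (n1 ^ 2 + n2 ^ 2) * (p1 t + p4 t)) / 4);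
        [rewrite En; field | field].
    + transitivity ((2 * (p2 t + p3 t) + 2 * (n1 ^ 2 + n2 ^ 2) * (p2 t - p3 t)) / 4);
        [rewrite En; field | field].
    + transitivity ((2 * (p2 t + p3 t) - 2 * (n1 ^ 2 + n2 ^ 2) * (p2 t - p3 t)) / 4);
        [rewrite En; field | field].
    + transitivity (- (2 * (p1 t - p4 t) - 2 * (n1 ^ 2 + n2 ^ 2) * (p1 t + p4 t)) / 4);
        [rewrite En; field | field].
Qed.

End Reduced.

(** * Geodesics of the Jemisphere *)

Section Klein.

Variables (I0 eps : R).
Hypothesis heps : eps = 1 \/ eps = -1.

Definition height2 (x : R * R) : R := / 4 * I0 ^ 2 - fst x ^ 2 - snd x ^ 2.

Definition kronecker (i j : axis) : R :=
  match i, j with ax1, ax1 => 1 | ax2, ax2 => 1 | _, _ => 0 end.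

(** Obtained from the ambient metric by substituting [dw3 = - (w1 dw1 + w2 dw2) / w3], with
    [height2] equal to [w3 ^ 2] on the hemisphere. *)
Definition klein : metric := fun i j x =>
  (kronecker i j + coord i x * coord j x / height2 x) / height2 x.

Lemma partial_w3 (i : axis) (x : R * R) : 0 < height2 x ->
  partial i (fun y => w3 (hemisphere_param I0 eps y)) x = - eps * coord i x / sqrt (height2 x).
Proof.
  intros Hx. unfold height2 in *. destruct i; unfold partial, w3, hemisphere_param; cbn [fst snd coord];
  apply is_derive_unique; (auto_derive;
   [simpl in *; lra
   | match goal with |- context [/ (2 * sqrt ?e)] =>
       replace e with (/ 4 * I0 ^ 2 - fst x ^ 2 - snd x ^ 2) by ring end;
     pose proof (sqrt_lt_R0 _ Hx); field; lra]).
Qed.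

Lemma jemisphere_klein (i j : axis) (x : R * R) : 0 < height2 x ->
  jemisphere_metric I0 eps i j x = klein i j x.
Proof.
  intros Hx. set (X := hemisphere_param I0 eps).
  change ((partial i (fun y => w1 (X y)) x * partial j (fun y => w1 (X y)) x
    + partial i (fun y => w2 (X y)) x * partial j (fun y => w2 (X y)) x
    + partial i (fun y => w3 (X y)) x * partial j (fun y => w3 (X y)) x)
    / (eps * sqrt (height2 x)) ^ 2 = klein i j x).
  assert (E1 : forall i, partial i (fun y => w1 (X y)) x = kronecker i ax1).
  { intros []; unfold partial, w1, X, hemisphere_param; simpl; [apply Derive_id | apply Derive_const]. }
  assert (E2 : forall i, partial i (fun y => w2 (X y)) x = kronecker i ax2).
  { intros []; unfold partial, w2, X, hemisphere_param; simpl; [apply Derive_const | apply Derive_id]. }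
  rewrite !E1, !E2. unfold X. rewrite !partial_w3 by exact Hx.
  unfold klein. pose proof (sqrt_lt_R0 _ Hx) as Hq.
  pose proof (pow2_sqrt _ (Rlt_le _ _ Hx)) as Eq. set (q := sqrt (height2 x)) in *.
  rewrite <- Eq. destruct heps as [-> | ->]; destruct i, j; unfold kronecker; field; lra.
Qed.

Definition dklein (l i j : axis) (x : R * R) : R :=
  (2 * kronecker i j * coord l x + kronecker l i * coord j x + kronecker l j * coord i x)
    / height2 x ^ 2
  + 4 * coord l x * coord i x * coord j x / height2 x ^ 3.

(** The metric agrees with [klein] only over the open disc, so differentiating one in place of the
    other needs a neighbourhood of the point along each axis. *)
Lemma locally_height2 (x : R * R) : 0 < height2 x ->
  locally (fst x) (fun s => 0 < height2 (s, snd x)) /\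
  locally (snd x) (fun s => 0 < height2 (fst x, s)).
Proof.
  intros Hx. split.
  - assert (Hc : continuous (fun s => height2 (s, snd x)) (fst x)).
    { apply (ex_derive_continuous (fun s : R => height2 (s, snd x)) (fst x)). unfold height2; cbn [fst snd]. auto_derive. exact I. }
    apply (Hc (fun y => 0 < y)). apply (open_gt 0). destruct x; exact Hx.
  - assert (Hc : continuous (fun s => height2 (fst x, s)) (snd x)).
    { apply (ex_derive_continuous (fun s : R => height2 (fst x, s)) (snd x)). unfold height2; cbn [fst snd]. auto_derive. exact I. }
    apply (Hc (fun y => 0 < y)). apply (open_gt 0). destruct x; exact Hx.
Qed.

Lemma partial_jemisphere (l i j : axis) (x : R * R) : 0 < height2 x ->
  partial l (jemisphere_metric I0 eps i j) x = dklein l i j x.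
Proof.
  intros Hx. destruct (locally_height2 x Hx) as [L1 L2]. unfold height2 in Hx.
  destruct l; unfold partial.
  - rewrite (Derive_ext_loc _ (fun s => klein i j (s, snd x))).
    2:{ eapply filter_imp; [|exact L1]. intros s Hs. apply jemisphere_klein; exact Hs. }
    apply is_derive_unique. unfold klein, dklein, height2.
    destruct i, j; unfold kronecker; cbn [coord fst snd];
      (auto_derive; [simpl in *; repeat split; nra | field; simpl in *; lra]).
  - rewrite (Derive_ext_loc _ (fun s => klein i j (fst x, s))).
    2:{ eapply filter_imp; [|exact L2]. intros s Hs. apply jemisphere_klein; exact Hs. }
    apply is_derive_unique. unfold klein, dklein, height2.
    destruct i, j; unfold kronecker; cbn [coord fst snd];
      (auto_derive; [simpl in *; repeat split; nra | field; simpl in *; lra]).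
Qed.

(** In the chart [(w1, w2)] the Jemisphere is the Klein model, whose Christoffel symbols are
    pure trace: its geodesics are straight chords. *)
Lemma christoffel_jemisphere (l i j : axis) (x : R * R) : 0 < height2 x ->
  christoffel (jemisphere_metric I0 eps) l i j x =
  (kronecker l i * coord j x + kronecker l j * coord i x) / height2 x.
Proof.
  intros Hx. unfold christoffel, sum_axes.
  rewrite !partial_jemisphere by exact Hx.
  unfold metric_inv. rewrite !jemisphere_klein by exact Hx.
  unfold klein, dklein.
  assert (HR : / 4 * I0 ^ 2 = height2 x + fst x ^ 2 + snd x ^ 2) by (unfold height2; ring).
  set (h := height2 x) in *. clearbody h. destruct x as [x y].
  (* This sum is [h ^ 3] times the determinant by which [metric_inv] divides. *)
  assert (h + x ^ 2 + y ^ 2 <> 0) by nra.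
  destruct l, i, j; unfold kronecker; cbn [coord fst snd]; field; split; nra.
Qed.

(** Contracting pure-trace symbols with the velocity twice leaves a multiple of the velocity, so the
    equation concerns only the speed along a line. *)
Lemma geodesic_of_klein (u1 u2 v1 v2 : R -> R) :
  (forall s, 0 < height2 (u1 s, u2 s)) ->
  (forall s, is_derive u1 s (v1 s)) -> (forall s, is_derive u2 s (v2 s)) ->
  (forall s, is_derive v1 s
     (- (2 * (u1 s * v1 s + u2 s * v2 s) / height2 (u1 s, u2 s) * v1 s))) ->
  (forall s, is_derive v2 s
     (- (2 * (u1 s * v1 s + u2 s * v2 s) / height2 (u1 s, u2 s) * v2 s))) ->
  forall a b, geodesic_in_coords (jemisphere_metric I0 eps) a b (fun s => (u1 s, u2 s)).
Proof.
  intros Hh D1 D2 A1 A2 a b s _ l d.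
  assert (E1 : forall r, d ax1 r = v1 r) by (intros r; apply is_derive_unique, D1).
  assert (E2 : forall r, d ax2 r = v2 r) by (intros r; apply is_derive_unique, D2).
  split; [destruct l; [exists (v1 s); apply D1 | exists (v2 s); apply D2]|].
  assert (A : is_derive (d l) s
     (- (2 * (u1 s * v1 s + u2 s * v2 s) / height2 (u1 s, u2 s)
         * (match l with ax1 => v1 | ax2 => v2 end s)))).
  { destruct l; (eapply is_derive_ext; [intros r; symmetry; first [apply E1 | apply E2]|]);
      [apply A1 | apply A2]. }
  split; [eexists; exact A|]. rewrite (is_derive_unique _ _ _ A).
  unfold sum_axes. rewrite !christoffel_jemisphere by apply Hh. rewrite E1, E2.
  specialize (Hh s).
  destruct l; unfold kronecker; cbn [coord fst snd]; field; lra.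
Qed.

(** * Chords as complete geodesics *)

Section Chord.

Variables (n1 n2 c0 r : R).
Hypotheses (hn : n1 ^ 2 + n2 ^ 2 = 1) (hr : 0 < r) (hr2 : r ^ 2 = / 4 * I0 ^ 2 - c0 ^ 2).

Definition chord (x : R) : R * R := (n1 * c0 - n2 * x, n2 * c0 + n1 * x).

(** [r * tanh (s / 2)]. *)
Definition chord_position (s : R) : R := r * (exp s - 1) / (exp s + 1).

Lemma height2_chord (x : R) : height2 (chord x) = r ^ 2 - x ^ 2.
Proof.
  rewrite hr2. unfold height2, chord; cbn [fst snd].
  transitivity (/ 4 * I0 ^ 2 - (n1 ^ 2 + n2 ^ 2) * (c0 ^ 2 + x ^ 2)); [ring | rewrite hn; ring].
Qed.

Lemma height2_position (s : R) :
  r ^ 2 - chord_position s ^ 2 = r ^ 2 * (4 * exp s) / (exp s + 1) ^ 2.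
Proof. pose proof (exp_pos s). unfold chord_position. field. lra. Qed.

Lemma height2_position_pos (s : R) : 0 < r ^ 2 - chord_position s ^ 2.
Proof.
  rewrite height2_position. pose proof (exp_pos s).
  apply Rdiv_lt_0_compat; [|apply pow_lt; lra].
  apply Rmult_lt_0_compat; [apply pow_lt; exact hr | lra].
Qed.

Lemma hemisphere_chord (x : R) : x ^ 2 < r ^ 2 ->
  hemisphere I0 eps (hemisphere_param I0 eps (chord x)).
Proof.
  intros Hx. pose proof (height2_chord x) as E.
  assert (Hh : 0 < height2 (chord x)) by lra.
  pose proof (sqrt_lt_R0 _ Hh) as Hq. pose proof (pow2_sqrt _ (Rlt_le _ _ Hh)) as Eq.
  unfold hemisphere, hemisphere_param, w1, w2, w3; cbn [fst snd].
  fold (height2 (chord x)). set (q := sqrt (height2 (chord x))) in *.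
  unfold height2, chord in *; cbn [fst snd] in *.
  destruct heps as [-> | ->]; split; lra.
Qed.

(** Hyperbolic arc length along the chord is [artanh (x / r)], so [chord_position] has constant
    speed [1 / 2]. The half keeps it rational in [exp s]. *)
Lemma chord_geodesic :
  jemisphere_geodesic I0 eps m_infty p_infty
    (fun s => hemisphere_param I0 eps (chord (chord_position s))).
Proof.
  split.
  - intros s _. apply hemisphere_chord. pose proof (height2_position_pos s). lra.
  - unfold chord, w1, w2, hemisphere_param; cbn [fst snd].
    set (V := fun s => r * (2 * exp s) / (exp s + 1) ^ 2).
    assert (D : forall s, is_derive chord_position s (V s)).
    { intros s. pose proof (exp_pos s). unfold chord_position, V. auto_derive; [lra|]. field. lra. }
    assert (DV : forall s,
      is_derive V s (- (2 * chord_position s * V s / (r ^ 2 - chord_position s ^ 2) * V s))).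
    { intros s. rewrite height2_position. pose proof (exp_pos s). unfold chord_position, V.
      auto_derive; [simpl; nra|]. field. lra. }
    apply (geodesic_of_klein
      (fun s => n1 * c0 - n2 * chord_position s) (fun s => n2 * c0 + n1 * chord_position s)
      (fun s => - n2 * V s) (fun s => n1 * V s)).
    + intros s. change (0 < height2 (chord (chord_position s))).
      rewrite height2_chord. apply height2_position_pos.
    + intros s. specialize (D s). derive_known. ring.
    + intros s. specialize (D s). derive_known. ring.
    + intros s. change (height2 (_, _)) with (height2 (chord (chord_position s))).
      rewrite height2_chord. specialize (DV s). derive_known.
      (* The dot product of position and velocity is [(n1 ^ 2 + n2 ^ 2) * x * x']; the factor [1] is
         there to be rewritten by [hn]. *)
      transitivity (- n2 * (- (2 * (chord_position s * V s * 1) / (r ^ 2 - chord_position s ^ 2) * V s)));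
        [unfold Rdiv; ring|]. rewrite <- hn. unfold Rdiv; ring.
    + intros s. change (height2 (_, _)) with (height2 (chord (chord_position s))).
      rewrite height2_chord. specialize (DV s). derive_known.
      transitivity (n1 * (- (2 * (chord_position s * V s * 1) / (r ^ 2 - chord_position s ^ 2) * V s)));
        [unfold Rdiv; ring|]. rewrite <- hn. unfold Rdiv; ring.
Qed.

Lemma chord_reparametrization (a b : Rbar) (x0 sg t0 : R) (W : R -> R3) :
  0 < sg ->
  (forall t, inside a b t <-> (x0 + sg * (t - t0)) ^ 2 < r ^ 2) ->
  (forall t, inside a b t -> W t = hemisphere_param I0 eps (chord (x0 + sg * (t - t0)))) ->
  reparametrization a b W m_infty p_infty
    (fun s => hemisphere_param I0 eps (chord (chord_position s))).
Proof.
  intros Hsg Hin HW.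
  set (x := fun t => x0 + sg * (t - t0)).
  (* [2 artanh (x / r)], the inverse of [chord_position], at the affine parameter [x]. *)
  set (tau := fun t => ln (r + x t) - ln (r - x t)).
  assert (Hb : forall t, inside a b t -> - r < x t < r).
  { intros t Ht. apply Hin in Ht. fold (x t) in Ht. split; nra. }
  assert (D : forall t, inside a b t -> is_derive tau t (2 * r * sg / (r ^ 2 - x t ^ 2))).
  { intros t Ht. specialize (Hb t Ht). unfold tau, x in *. auto_derive; [repeat split; lra|].
    field. repeat split; nra. }
  exists tau. split.
  - intros t Ht. pose proof (Hb t Ht) as Hxt. repeat split.
    + eexists. exact (D t Ht).
    + eapply (continuous_ext_loc _ (fun s => 2 * r * sg / (r ^ 2 - x s ^ 2))).
      * assert (Hc : continuous x t).
        { apply (ex_derive_continuous x t). unfold x. auto_derive. exact I. }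
        assert (L : locally t (fun s => - r < x s < r)).
        { apply (Hc (fun y => - r < y < r)). apply (locally_interval _ _ (- r) r); simpl; tauto || lra. }
        eapply filter_imp; [|exact L]. intros s Hs. symmetry. apply is_derive_unique, D, Hin.
        fold (x s). nra.
      * apply (ex_derive_continuous (fun s => 2 * r * sg / (r ^ 2 - x s ^ 2)) t).
        unfold x in *. auto_derive. simpl in *. nra.
    + rewrite (is_derive_unique _ _ _ (D t Ht)).
      assert (0 < 2 * r * sg / (r ^ 2 - x t ^ 2)); [|lra].
      apply Rdiv_lt_0_compat; nra.
    + rewrite (HW t Ht). fold (x t). f_equal. f_equal. unfold chord_position.
      replace (exp (tau t)) with ((r + x t) / (r - x t)); [field; lra|].
      unfold tau, Rminus at 2. rewrite exp_plus, exp_Ropp, !exp_ln by lra. reflexivity.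
  - intros s _. exists (t0 + (chord_position s - x0) / sg).
    assert (E : x (t0 + (chord_position s - x0) / sg) = chord_position s) by (unfold x; field; lra).
    split.
    + apply Hin. fold (x (t0 + (chord_position s - x0) / sg)). rewrite E.
      pose proof (height2_position_pos s). lra.
    + unfold tau. rewrite E. pose proof (exp_pos s) as He.
      replace (r + chord_position s) with (exp s * (r - chord_position s))
        by (unfold chord_position; field; lra).
      assert (0 < r - chord_position s).
      { replace (r - chord_position s) with (2 * r / (exp s + 1)) by (unfold chord_position; field; lra).
        apply Rdiv_lt_0_compat; lra. }
      rewrite ln_mult, ln_exp by assumption. ring.
Qed.

End Chord.

End Klein.

(** * Conservation laws and maximality *)

(** Lagrange's identity on velocities: the inertia formula yields the sum of the [m i * |v i|^2]
    minus [|P|^2] over the total mass, and [P = 0]. *)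
Lemma norm2_jacobi_velocity (m : body -> R) (v : config) : (forall i, 0 < m i) ->
  linear_momentum m v = RtoC 0 ->
  norm2 (jacobi1 m v) (jacobi2 m v) = sum_bodies (fun i => m i * Cmod (v i) ^ 2).
Proof.
  intros hm HP. rewrite <- (inertia_jacobi m hm). rewrite (inertia_real m hm).
  assert (HR : m b1 * Re (v b1) + m b2 * Re (v b2) + m b3 * Re (v b3) = 0).
  { transitivity (Re (linear_momentum m v)); [|rewrite HP; reflexivity].
    unfold linear_momentum, sum_bodies, Re; simpl; unfold plus; simpl. ring. }
  assert (HI : m b1 * Im (v b1) + m b2 * Im (v b2) + m b3 * Im (v b3) = 0).
  { transitivity (Im (linear_momentum m v)); [|rewrite HP; reflexivity].
    unfold linear_momentum, sum_bodies, Im; simpl; unfold plus; simpl. ring. }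
  unfold sum_bodies, plus; simpl. rewrite <- !Rmult_assoc.
  pose proof (hm b1); pose proof (hm b2); pose proof (hm b3).
  pose proof (Cmod_sqr (v b1)) as C1. pose proof (Cmod_sqr (v b2)) as C2.
  pose proof (Cmod_sqr (v b3)) as C3. simpl in C1, C2, C3.
  rewrite !Rmult_1_r in *. rewrite !(Rmult_assoc (m _) (Cmod _)), C1, C2, C3.
  apply (Rmult_eq_reg_r (m b1 + m b2 + m b3)); [|lra].
  match goal with |- _ = ?r =>
    transitivity (r - (m b1 * Re (v b1) + m b2 * Re (v b2) + m b3 * Re (v b3)) ^ 2
                    - (m b1 * Im (v b1) + m b2 * Im (v b2) + m b3 * Im (v b3)) ^ 2) end.
  - field. lra.
  - rewrite HR, HI. ring.
Qed.

Lemma wedge_real (z z' : C) : wedge z z' = Re z * Im z' - Im z * Re z'.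
Proof. unfold wedge, Re, Im; simpl; ring. Qed.

(** The left side is the angular momentum about the barycenter. It differs from the one about the
    origin by the wedge of the barycenter with [P]. *)
Lemma wedge_jacobi_velocity (m : body -> R) (q v : config) : (forall i, 0 < m i) ->
  linear_momentum m v = RtoC 0 ->
  wedge (jacobi1 m q) (jacobi1 m v) + wedge (jacobi2 m q) (jacobi2 m v) =
  angular_momentum m q v.
Proof.
  intros hm HP.
  assert (HR : m b1 * Re (v b1) + m b2 * Re (v b2) + m b3 * Re (v b3) = 0).
  { transitivity (Re (linear_momentum m v)); [|rewrite HP; reflexivity].
    unfold linear_momentum, sum_bodies, Re; simpl; unfold plus; simpl. ring. }
  assert (HI : m b1 * Im (v b1) + m b2 * Im (v b2) + m b3 * Im (v b3) = 0).
  { transitivity (Im (linear_momentum m v)); [|rewrite HP; reflexivity].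
    unfold linear_momentum, sum_bodies, Im; simpl; unfold plus; simpl. ring. }
  unfold angular_momentum, sum_bodies, plus; simpl. rewrite !wedge_real.
  rewrite !jacobi1_re, !jacobi1_im, !jacobi2_re, !jacobi2_im by exact hm.
  pose proof (hm b1); pose proof (hm b2); pose proof (hm b3).
  pose proof (pow2_sqrt _ (Rlt_le _ _ (mu1_pos m hm))) as Er1.
  pose proof (pow2_sqrt _ (Rlt_le _ _ (mu2_pos m hm))) as Er2.
  set (r1 := sqrt (mu1 m)) in *. set (r2 := sqrt (mu2 m)) in *.
  match goal with |- ?l = ?r =>
    transitivity (r - ((m b1 * Re (q b1) + m b2 * Re (q b2) + m b3 * Re (q b3))
        * (m b1 * Im (v b1) + m b2 * Im (v b2) + m b3 * Im (v b3))
      - (m b1 * Im (q b1) + m b2 * Im (q b2) + m b3 * Im (q b3))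
        * (m b1 * Re (v b1) + m b2 * Re (v b2) + m b3 * Re (v b3))) / total_mass m) end.
  2: { rewrite HR, HI. unfold total_mass. field. lra. }
  set (X1 := Re (q b2) - Re (q b1)). set (Y1 := Im (q b2) - Im (q b1)).
  set (V1 := Re (v b2) - Re (v b1)). set (W1 := Im (v b2) - Im (v b1)).
  set (X2 := Re (q b3) - _). set (Y2 := Im (q b3) - _).
  set (V2 := Re (v b3) - _). set (W2 := Im (v b3) - _).
  transitivity (r1 ^ 2 * (X1 * W1 - Y1 * V1) + r2 ^ 2 * (X2 * W2 - Y2 * V2)); [ring|].
  rewrite Er1, Er2. unfold X1, Y1, V1, W1, X2, Y2, V2, W2, mu1, mu2, total_mass. field. lra.
Qed.

Lemma is_derive_jacobi (m : body -> R) (c : R -> config) (t : R) (c' : config) :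
  (forall i, 0 < m i) -> (forall i, is_derive (fun s => c s i) t (c' i)) ->
  is_derive (fun s => Re (jacobi1 m (c s))) t (Re (jacobi1 m c')) /\
  is_derive (fun s => Im (jacobi1 m (c s))) t (Im (jacobi1 m c')) /\
  is_derive (fun s => Re (jacobi2 m (c s))) t (Re (jacobi2 m c')) /\
  is_derive (fun s => Im (jacobi2 m (c s))) t (Im (jacobi2 m c')).
Proof.
  intros hm H. pose proof (hm b1); pose proof (hm b2).
  destruct (proj1 (is_derive_C_iff _ _ _) (H b1)) as [R1 I1].
  destruct (proj1 (is_derive_C_iff _ _ _) (H b2)) as [R2 I2].
  destruct (proj1 (is_derive_C_iff _ _ _) (H b3)) as [R3 I3].
  assert (F1 : forall (f g : R -> R) f' g' r, is_derive f t f' -> is_derive g t g' ->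
    is_derive (fun s => r * (f s - g s)) t (r * (f' - g'))).
  { intros f g f' g' r Hf Hg. derive_known. ring. }
  assert (F2 : forall (f g h : R -> R) f' g' h' r, is_derive f t f' -> is_derive g t g' ->
    is_derive h t h' ->
    is_derive (fun s => r * (h s - (m b1 * f s + m b2 * g s) / (m b1 + m b2))) t
      (r * (h' - (m b1 * f' + m b2 * g') / (m b1 + m b2)))).
  { intros f g h f' g' h' r Hf Hg Hh. derive_known. field. lra. }
  rewrite jacobi1_re, jacobi1_im, jacobi2_re, jacobi2_im by exact hm.
  split; [|split; [|split]]; eapply is_derive_ext.
  2: apply F1; [exact R2 | exact R1].
  3: apply F1; [exact I2 | exact I1].
  4: apply F2; [exact R1 | exact R2 | exact R3].
  5: apply F2; [exact I1 | exact I2 | exact I3].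
  - intros s; symmetry; apply jacobi1_re.
  - intros s; symmetry; apply jacobi1_im.
  - intros s; symmetry; apply jacobi2_re; exact hm.
  - intros s; symmetry; apply jacobi2_im; exact hm.
Qed.

Lemma shape_real (m : body -> R) (q : config) :
  shape m q =
  (/ 2 * (Re (jacobi1 m q) ^ 2 + Im (jacobi1 m q) ^ 2
          - Re (jacobi2 m q) ^ 2 - Im (jacobi2 m q) ^ 2),
   Re (jacobi1 m q) * Re (jacobi2 m q) + Im (jacobi1 m q) * Im (jacobi2 m q),
   Re (jacobi1 m q) * Im (jacobi2 m q) - Im (jacobi1 m q) * Re (jacobi2 m q)).
Proof.
  unfold shape. rewrite !Cmod_sqr. repeat apply injective_projections; cbn [fst snd]; unfold Re, Im;
    simpl; ring.
Qed.

Lemma barycenter_constant (m : body -> R) (a b : Rbar) (q v : R -> config) (s t : R) :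
  (forall i, 0 < m i) ->
  (forall t, inside a b t -> forall i, is_derive (fun s => q s i) t (v t i)) ->
  (forall t, inside a b t -> linear_momentum m (v t) = RtoC 0) ->
  inside a b s -> inside a b t -> barycenter m (q s) = barycenter m (q t).
Proof.
  intros hm Hq HP Hs Ht. pose proof (hm b1); pose proof (hm b2); pose proof (hm b3).
  assert (F : forall (f g h : R -> R) f' g' h' r, is_derive f r f' -> is_derive g r g' ->
    is_derive h r h' -> m b1 * f' + m b2 * g' + m b3 * h' = 0 ->
    is_derive (fun s => (m b1 * f s + m b2 * g s + m b3 * h s) / total_mass m) r 0).
  { intros f g h f' g' h' r Hf Hg Hh E. unfold total_mass. derive_known.
    transitivity ((m b1 * f' + m b2 * g' + m b3 * h') / (m b1 + m b2 + m b3)); [field; lra|].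
    rewrite E. field. lra. }
  assert (ER : forall c, Re (barycenter m c)
    = (m b1 * Re (c b1) + m b2 * Re (c b2) + m b3 * Re (c b3)) / total_mass m).
  { intros c. unfold barycenter, sum_bodies, total_mass, Re; simpl; unfold plus; simpl. field. lra. }
  assert (EI : forall c, Im (barycenter m c)
    = (m b1 * Im (c b1) + m b2 * Im (c b2) + m b3 * Im (c b3)) / total_mass m).
  { intros c. unfold barycenter, sum_bodies, total_mass, Im; simpl; unfold plus; simpl. field. lra. }
  apply injective_projections.
  - change (Re (barycenter m (q s)) = Re (barycenter m (q t))). rewrite !ER.
    apply (constant_on_interval a b (fun t =>
      (m b1 * Re (q t b1) + m b2 * Re (q t b2) + m b3 * Re (q t b3)) / total_mass m)); try assumption.
    intros u Hu.
    destruct (proj1 (is_derive_C_iff _ _ _) (Hq u Hu b1)) as [R1 _].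
    destruct (proj1 (is_derive_C_iff _ _ _) (Hq u Hu b2)) as [R2 _].
    destruct (proj1 (is_derive_C_iff _ _ _) (Hq u Hu b3)) as [R3 _].
    refine (F _ _ _ _ _ _ u R1 R2 R3 _).
    transitivity (Re (linear_momentum m (v u))); [|rewrite (HP u Hu); reflexivity].
    unfold linear_momentum, sum_bodies, Re; simpl; unfold plus; simpl. ring.
  - change (Im (barycenter m (q s)) = Im (barycenter m (q t))). rewrite !EI.
    apply (constant_on_interval a b (fun t =>
      (m b1 * Im (q t b1) + m b2 * Im (q t b2) + m b3 * Im (q t b3)) / total_mass m)); try assumption.
    intros u Hu.
    destruct (proj1 (is_derive_C_iff _ _ _) (Hq u Hu b1)) as [_ R1].
    destruct (proj1 (is_derive_C_iff _ _ _) (Hq u Hu b2)) as [_ R2].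
    destruct (proj1 (is_derive_C_iff _ _ _) (Hq u Hu b3)) as [_ R3].
    refine (F _ _ _ _ _ _ u R1 R2 R3 _).
    transitivity (Im (linear_momentum m (v u))); [|rewrite (HP u Hu); reflexivity].
    unfold linear_momentum, sum_bodies, Im; simpl; unfold plus; simpl. ring.
Qed.

Lemma Rbar_between (a b : Rbar) : Rbar_lt a b -> exists t : R, inside a b t.
Proof.
  unfold inside. destruct a as [a | |], b as [b | |]; simpl; intros H; try tauto.
  - exists ((a + b) / 2); lra.
  - exists (a + 1); lra.
  - exists (b - 1); lra.
  - exists 0; tauto.
Qed.

Lemma inside_incl (a b a' b' : Rbar) : Rbar_lt a b ->
  (forall t, inside a b t -> inside a' b' t) -> Rbar_le a' a /\ Rbar_le b b'.
Proof.
  intros Hab H. destruct (Rbar_between a b Hab) as [t [Ht1 Ht2]]. split.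
  - apply Rbar_not_lt_le. intros L. destruct (Rbar_between a a' L) as [s [Hs1 Hs2]].
    (* The point [s] lies between [a] and [a'] but may exceed [b]; taking the minimum with [t] keeps
       it in the interval. *)
    assert (Hin : inside a b (Rmin s t)).
    { split; [apply Rmin_case; assumption|].
      apply Rbar_le_lt_trans with t; [apply Rmin_r | exact Ht2]. }
    apply H in Hin. destruct Hin as [Hin _].
    apply (Rbar_lt_not_le _ _ Hin). apply Rbar_le_trans with s; [apply Rmin_l|].
    apply Rbar_lt_le; exact Hs2.
  - apply Rbar_not_lt_le. intros L. destruct (Rbar_between b' b L) as [s [Hs1 Hs2]].
    assert (Hin : inside a b (Rmax s t)).
    { split; [|apply Rmax_case; assumption].
      apply Rbar_lt_le_trans with t; [exact Ht1 | apply Rmax_r]. }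
    apply H in Hin. destruct Hin as [_ Hin].
    apply (Rbar_lt_not_le _ _ Hin). apply Rbar_le_trans with s; [|apply Rmax_l].
    apply Rbar_lt_le; exact Hs1.
Qed.

Lemma newton_acceleration (m : body -> R) (gamma : R) (q : config) (acc : config) :
  (forall i, 0 < m i) -> signed_area q <> 0 ->
  (forall i, RtoC (m i) * acc i = - grad_body (potential m gamma) i q)%C ->
  let k := strength m gamma in
  forall i, acc i = of_jacobi m 0 (force1 k (jacobi1 m q) (jacobi2 m q))
                                  (force2 k (jacobi1 m q) (jacobi2 m q)) i.
Proof.
  intros hm Ha H k i. pose proof (newton_force m hm gamma q i Ha) as E. cbv zeta in E. fold k in E.
  rewrite <- (H i) in E.
  assert (Hi : RtoC (m i) <> 0%C) by (intros F; apply RtoC_inj in F; pose proof (hm i); lra).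
  transitivity (/ RtoC (m i) * (RtoC (m i) * acc i))%C; [field; exact Hi|].
  rewrite <- E. field. exact Hi.
Qed.

Lemma kinetic_norm2 (m : body -> R) (gamma : R) (q v : config) :
  (forall i, 0 < m i) -> signed_area q <> 0 -> linear_momentum m v = RtoC 0 ->
  energy m gamma q v = 0 ->
  norm2 (jacobi1 m v) (jacobi2 m v) =
  2 * strength m gamma * inertia m q / wedge (jacobi1 m q) (jacobi2 m q) ^ 2.
Proof.
  intros hm Ha HP HH. rewrite (norm2_jacobi_velocity m v hm HP), (wedge_jacobi m hm q).
  unfold energy in HH. set (K := sum_bodies _) in *. unfold potential in HH.
  pose proof (sqrt_lt_R0 _ (mu1_pos m hm)). pose proof (sqrt_lt_R0 _ (mu2_pos m hm)).
  pose proof (pow2_sqrt _ (Rlt_le _ _ (mu1_pos m hm))) as Er1.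
  pose proof (pow2_sqrt _ (Rlt_le _ _ (mu2_pos m hm))) as Er2.
  transitivity (2 * (gamma * inertia m q / signed_area q ^ 2)); [lra|].
  unfold strength. rewrite <- Er1, <- Er2 at 1.
  set (r1 := sqrt (mu1 m)) in *. set (r2 := sqrt (mu2 m)) in *. field. lra.
Qed.

Lemma strength_pos (m : body -> R) (gamma : R) :
  (forall i, 0 < m i) -> 0 < gamma -> 0 < strength m gamma.
Proof.
  intros hm Hg. pose proof (mu1_pos m hm). pose proof (mu2_pos m hm). unfold strength.
  apply Rmult_lt_0_compat; [apply Rmult_lt_0_compat; [lra | assumption] | assumption].
Qed.

Lemma w_of_chord (J c0 sg x0 t0 eps n1 n2 t : R) : n1 ^ 2 + n2 ^ 2 = 1 ->
  hemisphere_param J eps (chord n1 n2 c0 (x_of sg x0 t0 t)) =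
  (n1 * c0 - n2 * x_of sg x0 t0 t, n2 * c0 + n1 * x_of sg x0 t0 t, w_of J c0 sg x0 t0 eps t).
Proof.
  intros hn. unfold hemisphere_param, chord, w_of, rho2; cbn [fst snd].
  set (x := x_of _ _ _ _).
  replace (/ 4 * J ^ 2 - (n1 * c0 - n2 * x) ^ 2 - (n2 * c0 + n1 * x) ^ 2)
    with (/ 4 * J ^ 2 - c0 ^ 2 - x ^ 2); [reflexivity|].
  transitivity (/ 4 * J ^ 2 - (n1 ^ 2 + n2 ^ 2) * (c0 ^ 2 + x ^ 2)); [rewrite hn; ring | ring].
Qed.

(** * The given solution in explicit form *)

Section Solution.

Variables (m : body -> R) (gamma : R) (a b : Rbar) (q v : R -> config).
Hypotheses (hm : forall i, 0 < m i) (hgamma : 0 < gamma)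
  (hq : newton_solution m gamma a b q v)
  (hH : forall t, inside a b t -> energy m gamma (q t) (v t) = 0)
  (hP : forall t, inside a b t -> linear_momentum m (v t) = RtoC 0)
  (hJ : forall t, inside a b t -> angular_momentum m (q t) (v t) = 0)
  (hI : forall t, inside a b t -> Derive (fun s => inertia m (q s)) t = 0).

Lemma jacobi_velocity (t : R) : inside a b t ->
  is_derive (fun s => Re (jacobi1 m (q s))) t (Re (jacobi1 m (v t))) /\
  is_derive (fun s => Im (jacobi1 m (q s))) t (Im (jacobi1 m (v t))) /\
  is_derive (fun s => Re (jacobi2 m (q s))) t (Re (jacobi2 m (v t))) /\
  is_derive (fun s => Im (jacobi2 m (q s))) t (Im (jacobi2 m (v t))).
Proof. intros Ht. apply is_derive_jacobi; [exact hm|]. intros i. apply (hq t Ht). Qed.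

Lemma jacobi_acceleration (t : R) : inside a b t ->
  let F1 := force1 (strength m gamma) (jacobi1 m (q t)) (jacobi2 m (q t)) in
  let F2 := force2 (strength m gamma) (jacobi1 m (q t)) (jacobi2 m (q t)) in
  is_derive (fun s => Re (jacobi1 m (v s))) t (Re F1) /\
  is_derive (fun s => Im (jacobi1 m (v s))) t (Im F1) /\
  is_derive (fun s => Re (jacobi2 m (v s))) t (Re F2) /\
  is_derive (fun s => Im (jacobi2 m (v s))) t (Im F2).
Proof.
  intros Ht F1 F2. destruct (hq t Ht) as [Ha Hi].
  destruct (Hi b1) as [_ [a1 [D1 E1]]]. destruct (Hi b2) as [_ [a2 [D2 E2]]].
  destruct (Hi b3) as [_ [a3 [D3 E3]]].
  set (acc := fun i => match i with b1 => a1 | b2 => a2 | b3 => a3 end).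
  assert (Eacc : forall i, acc i = of_jacobi m 0 F1 F2 i).
  { apply newton_acceleration; [exact hm | exact Ha|]. intros []; assumption. }
  (* The forces are written as Jacobi vectors of the accelerations, so that linearity of the
     coordinates applies. *)
  rewrite <- (jacobi1_of_jacobi m hm 0 F1 F2).
  rewrite <- (jacobi2_of_jacobi m hm 0 F1 F2) at 3 4.
  apply is_derive_jacobi; [exact hm|]. intros i. rewrite <- Eacc. destruct i; assumption.
Qed.

Lemma inertia_derivative (t : R) : inside a b t ->
  Re (jacobi1 m (q t)) * Re (jacobi1 m (v t)) + Im (jacobi1 m (q t)) * Im (jacobi1 m (v t))
  + Re (jacobi2 m (q t)) * Re (jacobi2 m (v t)) + Im (jacobi2 m (q t)) * Im (jacobi2 m (v t)) = 0
  /\ is_derive (fun s => inertia m (q s)) t 0.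
Proof.
  intros Ht. destruct (jacobi_velocity t Ht) as (D1 & D2 & D3 & D4).
  assert (F : forall (f g h l : R -> R) f' g' h' l', is_derive f t f' -> is_derive g t g' ->
    is_derive h t h' -> is_derive l t l' ->
    is_derive (fun s => f s ^ 2 + g s ^ 2 + h s ^ 2 + l s ^ 2) t
      (2 * (f t * f' + g t * g' + h t * h' + l t * l'))).
  { intros f g h l f' g' h' l' Hf Hg Hh Hl. derive_known. ring. }
  specialize (F _ _ _ _ _ _ _ _ D1 D2 D3 D4). cbv beta in F.
  (* [hI] gives only the value of [Derive]; differentiability comes from the velocities. *)
  match type of F with is_derive _ _ ?l =>
    assert (D : is_derive (fun s : R => inertia m (q s)) t l) end.
  { eapply is_derive_ext; [|exact F]. intros s. symmetry. apply inertia_jacobi; exact hm. }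
  pose proof (is_derive_unique _ _ _ D) as E. rewrite (hI t Ht) in E.
  rewrite <- E in D. split; [lra | exact D].
Qed.

Lemma solution_explicit (t0 : R) : inside a b t0 ->
  exists J c0 sg x0 eps n1 n2 s01 s02 G,
    0 < J /\ 0 < J + 2 * c0 /\ 0 < J - 2 * c0 /\ 0 < sg /\ (eps = 1 \/ eps = -1) /\
    2 * strength m gamma * J ^ 2 = sg ^ 2 * (/ 4 * J ^ 2 - c0 ^ 2) /\ n1 ^ 2 + n2 ^ 2 = 1 /\
    s01 ^ 2 + s02 ^ 2 = 2 * J + 4 * c0 /\
    forall t, inside a b t ->
      x_of sg x0 t0 t ^ 2 < rho2 J c0 /\
      inertia m (q t) = J /\
      shape m (q t) = hemisphere_param J eps (chord n1 n2 c0 (x_of sg x0 t0 t)) /\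
      forall i, q t i = of_jacobi m G (Z1_of J c0 sg x0 t0 eps n1 n2 s01 s02 t)
                                      (Z2_of J c0 sg x0 t0 eps n1 n2 s01 s02 t) i.
Proof.
  intros Ht0. set (J := inertia m (q t0)). set (k := strength m gamma).
  assert (EJ : forall t, inside a b t -> inertia m (q t) = J).
  { intros t Ht. apply (constant_on_interval a b (fun s => inertia m (q s))); try assumption.
    intros s Hs. apply inertia_derivative; exact Hs. }
  set (p1 := fun t => Re (jacobi1 m (q t))). set (p2 := fun t => Im (jacobi1 m (q t))).
  set (p3 := fun t => Re (jacobi2 m (q t))). set (p4 := fun t => Im (jacobi2 m (q t))).
  set (u1 := fun t => Re (jacobi1 m (v t))). set (u2 := fun t => Im (jacobi1 m (v t))).
  set (u3 := fun t => Re (jacobi2 m (v t))). set (u4 := fun t => Im (jacobi2 m (v t))).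
  assert (Ew : forall t, wedge (jacobi1 m (q t)) (jacobi2 m (q t)) = p1 t * p4 t - p2 t * p3 t)
    by (intros t; apply wedge_real).
  assert (Hw : forall t, inside a b t -> p1 t * p4 t - p2 t * p3 t <> 0).
  { intros t Ht. rewrite <- Ew, (wedge_jacobi m hm).
    pose proof (sqrt_lt_R0 _ (mu1_pos m hm)). pose proof (sqrt_lt_R0 _ (mu2_pos m hm)).
    apply Rmult_integral_contrapositive; split; [nra|]. apply (hq t Ht). }
  assert (HN : forall t, inside a b t -> norm2 (jacobi1 m (q t)) (jacobi2 m (q t)) = J).
  { intros t Ht. rewrite <- (inertia_jacobi m hm). apply EJ, Ht. }
  assert (HF := jacobi_acceleration). cbv zeta in HF. fold k in HF.
  assert (Hang : forall t, inside a b t ->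
    p1 t * u2 t - p2 t * u1 t + (p3 t * u4 t - p4 t * u3 t) = 0).
  { intros t Ht. rewrite <- (hJ t Ht), <- (wedge_jacobi_velocity m (q t) (v t) hm (hP t Ht)).
    rewrite !wedge_real. reflexivity. }
  assert (Hen : forall t, inside a b t -> u1 t ^ 2 + u2 t ^ 2 + u3 t ^ 2 + u4 t ^ 2
    = 2 * k * J / (p1 t * p4 t - p2 t * p3 t) ^ 2).
  { intros t Ht. rewrite <- Ew, <- (EJ t Ht).
    apply (kinetic_norm2 m gamma (q t) (v t) hm); [apply (hq t Ht) | apply hP, Ht | apply hH, Ht]. }
  assert (HFr : forall t, inside a b t ->
    is_derive u1 t (2 * k / (p1 t * p4 t - p2 t * p3 t) ^ 2
      * (p1 t - J / (p1 t * p4 t - p2 t * p3 t) * p4 t)) /\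
    is_derive u2 t (2 * k / (p1 t * p4 t - p2 t * p3 t) ^ 2
      * (p2 t + J / (p1 t * p4 t - p2 t * p3 t) * p3 t)) /\
    is_derive u3 t (2 * k / (p1 t * p4 t - p2 t * p3 t) ^ 2
      * (p3 t + J / (p1 t * p4 t - p2 t * p3 t) * p2 t)) /\
    is_derive u4 t (2 * k / (p1 t * p4 t - p2 t * p3 t) ^ 2
      * (p4 t - J / (p1 t * p4 t - p2 t * p3 t) * p1 t))).
  { intros t Ht. specialize (HF t Ht). unfold force1, force2 in HF.
    rewrite (HN t Ht), Ew in HF. exact HF. }
  destruct (reduced_explicit a b k J p1 p2 p3 p4 u1 u2 u3 u4 Hw
    (fun t Ht => proj1 (jacobi_velocity t Ht))
    (fun t Ht => proj1 (proj2 (jacobi_velocity t Ht)))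
    (fun t Ht => proj1 (proj2 (proj2 (jacobi_velocity t Ht))))
    (fun t Ht => proj2 (proj2 (proj2 (jacobi_velocity t Ht))))
    (fun t Ht => proj1 (HFr t Ht))
    (fun t Ht => proj1 (proj2 (HFr t Ht)))
    (fun t Ht => proj1 (proj2 (proj2 (HFr t Ht))))
    (fun t Ht => proj2 (proj2 (proj2 (HFr t Ht))))
    HN (fun t Ht => proj1 (inertia_derivative t Ht)) Hang Hen t0
    (strength_pos m gamma hm hgamma) Ht0)
    as (c0 & sg & x0 & eps & n1 & n2 & s01 & s02 & HS & HD & Hsg & Heps & Ek & En & Es & Hall).
  exists J, c0, sg, x0, eps, n1, n2, s01, s02, (barycenter m (q t0)).
  split; [lra|]. do 7 (split; [assumption|]).
  intros t Ht. destruct (Hall t Ht) as (Hx & E1 & E2 & E3 & EZ1 & EZ2).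
  split; [exact Hx|]. split; [apply EJ, Ht|]. split.
  - rewrite (w_of_chord J c0 sg x0 t0 eps n1 n2 t En), shape_real, <- E1, <- E2, <- E3. reflexivity.
  - intros i. rewrite <- (of_jacobi_jacobi m hm (q t) i), <- EZ1, <- EZ2.
    rewrite (barycenter_constant m a b q v t0 t hm); try assumption.
    + unfold p1, p2, p3, p4, Re, Im. rewrite <- !surjective_pairing. reflexivity.
    + intros s Hs j. apply (hq s Hs).
Qed.

End Solution.

Theorem theorem1 (m : body -> R) (gamma : R) (a b : Rbar) (q v : R -> config)
  (hm : forall i, 0 < m i)
  (hgamma : 0 < gamma)
  (hab : Rbar_lt a b)
  (hq : maximal_newton_solution m gamma a b q v)
  (hH : forall t, inside a b t -> energy m gamma (q t) (v t) = 0)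
  (hP : forall t, inside a b t -> linear_momentum m (v t) = RtoC 0)
  (hJ : forall t, inside a b t -> angular_momentum m (q t) (v t) = 0)
  (hI : forall t, inside a b t -> Derive (fun s => inertia m (q s)) t = 0) :
  exists I0 : R,
    0 < I0 /\
    (forall t, inside a b t -> inertia m (q t) = I0) /\
    exists eps : R,
      (eps = 1 \/ eps = -1) /\
      (forall t, inside a b t -> hemisphere I0 eps (shape m (q t))) /\
      (exists (a' b' : Rbar) (c : R -> R3),
         jemisphere_geodesic I0 eps a' b' c /\
         reparametrization a b (fun t => shape m (q t)) a' b' c) /\
      (exists A B C0 : R,
         ~ (A = 0 /\ B = 0) /\
         forall w : R3,
           (exists t, inside a b t /\ shape m (q t) = w) <->
           hemisphere I0 eps w /\ A * w1 w + B * w2 w = C0).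
Proof.
  destruct (Rbar_between a b hab) as [t0 Ht0]. destruct hq as [hnewton hmax].
  destruct (solution_explicit m gamma a b q v hm hgamma hnewton hH hP hJ hI t0 Ht0)
    as (J & c0 & sg & x0 & eps & n1 & n2 & s01 & s02 & G & HJ & HS & HD & Hsg & Heps & Ek & En
        & Es & Hall).
  assert (Hrho : 0 < rho2 J c0) by (apply rho2_pos; assumption).
  set (r := sqrt (rho2 J c0)).
  assert (Hr : 0 < r) by (apply sqrt_lt_R0; exact Hrho).
  assert (Er : r ^ 2 = rho2 J c0) by (apply pow2_sqrt; lra). clearbody r.
  (* The times at which [x] reaches the two ends of the chord. *)
  set (a' := t0 + (- r - x0) / sg). set (b' := t0 + (r - x0) / sg).
  assert (Hin : forall t, inside a' b' t <-> x_of sg x0 t0 t ^ 2 < rho2 J c0).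
  { intros t. rewrite <- Er.
    assert (La : sg * (t - a') = x_of sg x0 t0 t + r) by (unfold a', x_of; field; lra).
    assert (Lb : sg * (b' - t) = r - x_of sg x0 t0 t) by (unfold b', x_of; field; lra).
    split.
    - intros [H1 H2]. simpl in H1, H2.
      assert (0 < sg * (t - a')) by (apply Rmult_lt_0_compat; lra).
      assert (0 < sg * (b' - t)) by (apply Rmult_lt_0_compat; lra). nra.
    - intros H. assert (H1 : - r < x_of sg x0 t0 t < r) by (split; nra).
      split; simpl; apply (Rmult_lt_reg_l sg); lra. }
  destruct (inside_incl a b a' b' hab) as [Ha Hb].
  { intros t Ht. apply Hin, Hall, Ht. }
  (* The explicit motion solves Newton's equations up to both ends and agrees with [q] on [(a, b)],
     so maximality identifies the two intervals. *)
  destruct (hmax a' b'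
    (fun t => of_jacobi m G (Z1_of J c0 sg x0 t0 eps n1 n2 s01 s02 t)
                            (Z2_of J c0 sg x0 t0 eps n1 n2 s01 s02 t))
    (fun t => of_jacobi m 0 (U1_of J c0 sg x0 t0 eps n1 n2 s01 s02 t)
                            (U2_of J c0 sg x0 t0 eps n1 n2 s01 s02 t)) Ha Hb) as [Eab Ebb].
  { intros t Ht. apply (explicit_newton J c0 sg x0 t0 eps (strength m gamma)); try assumption.
    - reflexivity.
    - apply Hin, Ht. }
  { intros t Ht i. symmetry. apply Hall, Ht. }
  rewrite Eab, Ebb in Hin. clear a' b' Ha Hb Eab Ebb hmax.
  assert (Er' : r ^ 2 = / 4 * J ^ 2 - c0 ^ 2) by exact Er.
  assert (Hhemi : forall t, inside a b t -> hemisphere J eps (shape m (q t))).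
  { intros t Ht. destruct (Hall t Ht) as (Hx & _ & -> & _).
    apply (hemisphere_chord J eps Heps n1 n2 c0 r En Er'). rewrite Er. exact Hx. }
  exists J. split; [exact HJ|]. split; [intros t Ht; apply Hall, Ht|].
  exists eps. split; [exact Heps|]. split; [exact Hhemi|]. split.
  - exists m_infty, p_infty, (fun s => hemisphere_param J eps (chord n1 n2 c0 (chord_position r s))).
    split; [apply chord_geodesic; assumption|].
    apply chord_reparametrization with x0 sg t0; try assumption.
    + intros t. rewrite Er. apply Hin.
    + intros t Ht. apply Hall, Ht.
  - exists n1, n2, c0. split.
    { intros [E1 E2]. rewrite E1, E2 in En. lra. }
    intros [[y1 y2] y3]. split.
    + intros (t & Ht & Ew). rewrite <- Ew. split; [apply Hhemi, Ht|].
      destruct (Hall t Ht) as (_ & _ & -> & _). unfold hemisphere_param, chord, w1, w2; cbn [fst snd].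
      set (x := x_of _ _ _ _).
      transitivity ((n1 ^ 2 + n2 ^ 2) * c0); [ring | rewrite En; ring].
    + intros [[E1 E2] E3]. unfold w1, w2, w3 in E1, E2, E3; cbn [fst snd] in E1, E2, E3.
      (* The coordinate of the given point along the chord. The motion visits it at time
         [t0 + (x - x0) / sg], which is admissible because [y3] is nonzero. *)
      set (x := n1 * y2 - n2 * y1).
      assert (F1 : y1 = n1 * c0 - n2 * x).
      { rewrite <- E3. unfold x. transitivity ((n1 ^ 2 + n2 ^ 2) * y1); [rewrite En; ring | ring]. }
      assert (F2 : y2 = n2 * c0 + n1 * x).
      { rewrite <- E3. unfold x. transitivity ((n1 ^ 2 + n2 ^ 2) * y2); [rewrite En; ring | ring]. }
      (* The hemisphere fixes the sign of [y3], so the chart coordinates determine the point. *)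
      assert (Ey3 : eps * sqrt (y3 ^ 2) = y3).
      { destruct Heps as [-> | ->].
        - rewrite sqrt_pow2 by lra. ring.
        - replace (y3 ^ 2) with ((- y3) ^ 2) by ring. rewrite sqrt_pow2 by lra. ring. }
      assert (Hx : x_of sg x0 t0 (t0 + (x - x0) / sg) = x) by (unfold x_of; field; lra).
      assert (Ht : inside a b (t0 + (x - x0) / sg)).
      { apply Hin. rewrite Hx. unfold rho2.
        assert (0 < y3 ^ 2) by (apply pow2_gt_0; intros E; rewrite E in E2; lra).
        assert (y1 ^ 2 + y2 ^ 2 = c0 ^ 2 + x ^ 2); [|lra].
        rewrite F1, F2. clearbody x.
        transitivity ((n1 ^ 2 + n2 ^ 2) * (c0 ^ 2 + x ^ 2)); [ring | rewrite En; ring]. }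
      exists (t0 + (x - x0) / sg). split; [exact Ht|].
      destruct (Hall _ Ht) as (_ & _ & -> & _). rewrite Hx.
      unfold hemisphere_param, chord; cbn [fst snd]. rewrite <- F1, <- F2.
      replace (/ 4 * J ^ 2 - y1 ^ 2 - y2 ^ 2) with (y3 ^ 2) by lra. rewrite Ey3. reflexivity.
Qed.
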